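(* Let $(R,\mathfrak m)$ be a Cohen-Macaulay local ring of dimension two with infinite residue field and let $I,J$ be $\mathfrak m$-primary ideals of $R$. Then the following statements are equivalent: (a) $r(I^k|J^k)=0$ for all $k\gg 0$; (b) $r(I^k|J^k)=0$ for some $k\gg 0$; (c) $e_{(1,0)}=e_1(I)$, $e_{(0,1)}=e_1(J)$, and $e_2(IJ)=e_2(I)+e_2(J)$; (d) there exists a joint reduction $(a,b)$ of $I$ and $J$ such that $M^1_{0,0}(a^k,b^k)=0$ for all $k\gg 0$.
   Context: $\ell$ denotes length of $R$-modules, and $I^0=J^0=R$. A pair $(a,b)$ is a joint reduction of $I$ and $J$ if $a\in I$, $b\in J$ and $I^{r+1}J^{s+1}=aI^rJ^{s+1}+bI^{r+1}J^s$ for some, and hence for all, $r,s\gg 0$. One writes $r(I|J)=0$ (joint reduction number zero) if there is a joint reduction $(a,b)$ of $I$ and $J$ with $IJ=aJ+bI$; $r(I^k|J^k)=0$ is the same condition for the ideals $I^k,J^k$. For $a\in I$, $b\in J$, $r,s\ge 0$, $k\ge1$: $M^1_{r,s}(a^k,b^k):=\dfrac{I^{r+k}J^{s+k}}{a^kI^rJ^{s+k}+b^kI^{r+k}J^s}$. Hilbert coefficients: for an $\mathfrak m$-primary ideal $K$, the integers $e_i(K)$ are defined by $\ell(R/K^n)=e_0(K)\binom{n+1}{2}-e_1(K)n+e_2(K)$ for $n\gg0$. Bigraded Hilbert coefficients $e_{(i,j)}$ of the filtration $\{I^rJ^s\}$: $\ell(R/I^rJ^s)=\sum_{i+j\le 2}(-1)^{i+j}e_{(i,j)}\binom{r+i-1}{i}\binom{s+j-1}{j}$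 for all $r,s\gg0$. *)

(* Defs.v *)
From HB Require Import structures.
From mathcomp Require Import all_boot all_algebra.
From mathcomp Require Import boolp classical_sets cardinality.

Set Implicit Arguments.
Unset Strict Implicit.
Unset Printing Implicit Defensive.
Import GRing.Theory.
Local Open Scope ring_scope.
Local Open Scope quotient_scope.

(* A submodule is a boolean predicate, but not necessarily a computable one:
   the predicates below are built with the classical truth value `[< _ >].
   Equality of submodules is extensional equality =i. The library's bundled
   submodClosed is not used because it does not carry closure under opposites,
   which {ideal_quot _} requires. *)
Record submodule (R : pzRingType) (V : lmodType R) := Submodule {
  submodule_pred :> {pred V};
  submoduleP : submod_closed submodule_pred
}.
HB.instance Definition _ (R : pzRingType) (V : lmodType R) (N : submodule V) :=
  GRing.isSubmodClosed.Build R V (submodule_pred N) (submoduleP N).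

Notation ideal R := (submodule R^o).

Section QuotientModule.
Variables (R : pzRingType) (V : lmodType R) (N : submodule V).

Definition quot_scale (a : R) (x : {ideal_quot N}) : {ideal_quot N} :=
  \pi_({ideal_quot N}) (a *: repr x).

Fact pi_quot_scale a x :
  quot_scale a (\pi_({ideal_quot N}) x) = \pi_({ideal_quot N}) (a *: x).
Proof.
rewrite /quot_scale; apply/eqP; rewrite -Quotient.idealrBE -scalerBr rpredZ //.
by rewrite Quotient.idealrBE reprK.
Qed.

Fact quot_scalerA a b x : quot_scale a (quot_scale b x) = quot_scale (a * b) x.
Proof. by elim/quotW: x => x; rewrite (pi_quot_scale b) !pi_quot_scale scalerA. Qed.

Fact quot_scale1r : left_id 1 quot_scale.
Proof. by move=> x; rewrite -[x]reprK pi_quot_scale scale1r. Qed.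

Fact quot_scalerDr : right_distributive quot_scale +%R.
Proof.
move=> a x y; rewrite -[x]reprK -[y]reprK -raddfD !pi_quot_scale.
by rewrite scalerDr raddfD.
Qed.

Fact quot_scalerDl x : {morph quot_scale^~ x : a b / a + b}.
Proof. by move=> a b /=; rewrite -[x]reprK !pi_quot_scale scalerDl raddfD. Qed.

HB.instance Definition _ := GRing.Zmodule_isLmodule.Build R {ideal_quot N}
  quot_scalerA quot_scale1r quot_scalerDr quot_scalerDl.

End QuotientModule.

Section Subquotient.
Variables (R : pzRingType) (V : lmodType R) (N K : submodule V).

Definition submod := {x : V | x \in N}.
HB.instance Definition _ := SubChoice.on submod.
HB.instance Definition _ := [SubChoice_isSubLmodule of submod by <:].

Definition sub_in : {pred submod} := fun x => \val x \in K.

Fact sub_in_submod_closed : submod_closed sub_in.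
Proof.
split=> [|a x y xK yK]; first by rewrite unfold_in raddf0 (rpred0 K).
by rewrite unfold_in linearP (rpredD (rpredZ a xK) yK).
Qed.
Definition sub_in_mod : submodule submod := Submodule sub_in_submod_closed.

(* The module N / K; in general N / (N :&: K). *)
Definition subquot : lmodType R := {ideal_quot sub_in_mod}.

End Subquotient.

Definition zero_module (R : pzRingType) (V : lmodType R) : Prop :=
  forall x : V, x = 0.

Definition proper_sub (T : Type) (A B : {pred T}) : Prop :=
  {subset A <= B} /\ ~ {subset B <= A}.

Definition is_max (P : nat -> Prop) (d : nat) : Prop :=
  P d /\ forall n, P n -> (n <= d)%N.

(* V has finite length l, i.e. l is the largest length of a strictly
   increasing chain of submodules of V. *)
Definition module_length (R : pzRingType) (V : lmodType R) (l : nat) : Prop :=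
  is_max (fun n => exists C : nat -> submodule V,
    forall i, (i < n)%N -> proper_sub (C i) (C i.+1)) l.

Section IdealOperations.
Variable R : comNzRingType.
Implicit Types (I J : ideal R) (a : R).

Definition ideal1_pred : {pred R^o} := predT.
Fact ideal1_closed : submod_closed ideal1_pred. Proof. by []. Qed.
Definition ideal1 : ideal R := Submodule ideal1_closed.

Definition addI_pred I J : {pred R^o} :=
  fun x => `[< exists y z, [/\ y \in I, z \in J & x = y + z] >].
Fact addI_closed I J : submod_closed (addI_pred I J).
Proof.
split; first by apply/asboolP; exists 0, 0; rewrite !rpred0 addr0.
move=> a _ _ /asboolP[y [z [yI zJ ->]]] /asboolP[y' [z' [yI' zJ' ->]]].
apply/asboolP; exists (a *: y + y'), (a *: z + z').
by rewrite !rpredD ?rpredZ // scalerDr addrACA.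
Qed.
Definition addI I J : ideal R := Submodule (addI_closed I J).

Definition mulI_pred I J : {pred R^o} :=
  fun x => `[< exists n (y z : 'I_n -> R^o),
    [/\ forall i, y i \in I, forall i, z i \in J & x = \sum_i y i * z i] >].
Fact mulI_closed I J : submod_closed (mulI_pred I J).
Proof.
split.
  by apply/asboolP; exists 0%N, (fun=> 0), (fun=> 0); split=> [[]|[]|]; rewrite ?big_ord0.
move=> a _ _ /asboolP[n [y [z [yI zJ ->]]]] /asboolP[p [y' [z' [yI' zJ' ->]]]].
apply/asboolP; exists (n + p)%N,
  (fun i => match split i with inl j => a *: y j | inr j => y' j end),
  (fun i => match split i with inl j => z j | inr j => z' j end).
split=> [i|i|]; [by case: split => j; rewrite ?rpredZ|by case: split|].
rewrite big_split_ord scaler_sumr; congr (_ + _); apply: eq_bigr => i _.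
  by rewrite (unsplitK (inl i)) scalerAl.
by rewrite (unsplitK (inr i)).
Qed.
Definition mulI I J : ideal R := Submodule (mulI_closed I J).

Definition scaleI_pred a I : {pred R^o} :=
  fun x => `[< exists2 y, y \in I & x = a * y >].
Fact scaleI_closed a I : submod_closed (scaleI_pred a I).
Proof.
split; first by apply/asboolP; exists 0; rewrite ?rpred0 ?mulr0.
move=> c _ _ /asboolP[y yI ->] /asboolP[z zI ->].
apply/asboolP; exists (c *: y + z); first by rewrite rpredD ?rpredZ.
by rewrite mulrDr; congr (_ + _); apply: mulrCA.
Qed.
Definition scaleI a I : ideal R := Submodule (scaleI_closed a I).

Definition expI I (n : nat) : ideal R := iter n (mulI I) ideal1.

End IdealOperations.

Declare Scope ideal_scope.
Delimit Scope ideal_scope with I.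
Notation "I + J" := (addI I J) : ideal_scope.
Notation "I * J" := (mulI I J) : ideal_scope.
Notation "a *: I" := (scaleI a%R I) : ideal_scope.
Notation "I ^+ n" := (expI I n) : ideal_scope.

Section LocalRings.
Variable R : comNzRingType.
Implicit Types (m P Q : ideal R).

Definition generated (s : seq R) (x : R) : Prop :=
  exists c : 'I_(size s) -> R, x = \sum_i c i * s`_i.

Definition noetherian : Prop :=
  forall Q, exists s, forall x, x \in Q <-> generated s x.

Definition maximal_ideal Q : Prop :=
  1 \notin Q /\ forall P, 1 \notin P -> {subset Q <= P} -> {subset P <= Q}.

Definition local_ring m : Prop :=
  maximal_ideal m /\ forall Q, maximal_ideal Q -> Q =i m.

Definition prime_ideal P : Prop := 1 \notin P /\ prime_idealr_closed P.

Definition krull_dim (d : nat) : Prop :=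
  is_max (fun n => exists P : nat -> ideal R,
    (forall i, (i <= n)%N -> prime_ideal (P i)) /\
    (forall i, (i < n)%N -> proper_sub (P i) (P i.+1))) d.

Definition regular_seq (s : seq R) : Prop :=
  ~ generated s 1 /\
  forall i, (i < size s)%N ->
    forall y, generated (take i s) (s`_i * y) -> generated (take i s) y.

Definition depth m (d : nat) : Prop :=
  is_max (fun n => exists s : seq R,
    [/\ size s = n, forall x : R, x \in s -> x \in m & regular_seq s]) d.

Definition cohen_macaulay m : Prop := exists2 d, krull_dim d & depth m d.

Definition primary_ideal Q : Prop :=
  1 \notin Q /\ forall x y : R, x * y \in Q -> x \in Q \/ exists n, y ^+ n \in Q.

Definition m_primary m Q : Prop :=
  primary_ideal Q /\ forall x : R, x \in m <-> exists n, x ^+ n \in Q.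

Definition infinite_residue_field m : Prop := infinite_set [set: {ideal_quot m}].

End LocalRings.

Section JointReductions.
Variable R : comNzRingType.
Implicit Types (I J K : ideal R) (a b : R).

Definition joint_reduction I J a b : Prop :=
  [/\ a \in I, b \in J & exists r s : nat,
    (I ^+ r.+1 * J ^+ s.+1)%I =i
      (a *: (I ^+ r * J ^+ s.+1) + b *: (I ^+ r.+1 * J ^+ s))%I].

Definition joint_reduction_number0 I J : Prop :=
  exists a b, joint_reduction I J a b /\ (I * J)%I =i (a *: J + b *: I)%I.

(* M1 I J k r s a b is the module $M^1_{r,s}(a^k, b^k)$. *)
Definition M1 I J (k r s : nat) a b : lmodType R :=
  subquot (I ^+ (r + k) * J ^+ (s + k))%I
    (a ^+ k *: (I ^+ r * J ^+ (s + k)) + b ^+ k *: (I ^+ (r + k) * J ^+ s))%I.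

Definition hilbert_coefs K (e : nat -> int) : Prop :=
  exists N, forall n, (N <= n)%N ->
    exists2 l, module_length {ideal_quot (K ^+ n)%I} l &
      l%:Z = e 0%N * 'C(n.+1, 2)%:Z - e 1%N * n%:Z + e 2%N.

Definition bigraded_hilbert_coefs I J (e : nat -> nat -> int) : Prop :=
  exists N, forall r s, (N <= r)%N -> (N <= s)%N ->
    exists2 l, module_length {ideal_quot (I ^+ r * J ^+ s)%I} l &
      l%:Z = \sum_(i < 3) \sum_(j < 3 | (i + j <= 2)%N)
        (-1) ^+ (i + j) * e i j * 'C(r + i - 1, i)%:Z * 'C(s + j - 1, j)%:Z.

(* The coefficients below are the unique integers satisfying the defining
   equations, obtained by classical description; the value 0 is only returned
   when no Hilbert polynomial of the above form exists, which does not happen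
   for ideals primary to the maximal ideal of a two-dimensional Noetherian
   local ring. Only indices i <= 2, resp. i + j <= 2, are meaningful. *)
Definition hilbert_coef K (i : nat) : int :=
  xget 0 [set c | exists2 e, hilbert_coefs K e & c = e i].

Definition bigraded_hilbert_coef I J (i j : nat) : int :=
  xget 0 [set c | exists2 e, bigraded_hilbert_coefs I J e & c = e i j].

End JointReductions.

(* Main.v *)
(* Lengths of quotients by ideals obey, for every pair (a, b) generating an ideal
   primary to m (such a pair is a regular sequence),
     l(R/(aU + bV)) + l(R/((U : b) cap (V : a))) = l(R/(a, b)) + l(R/U) + l(R/V).
   Put H(r, s) = l(R/I^rJ^s). For a joint reduction (a, b) this says that the
   mixed difference of H with steps (p, q) is pq l(R/(a, b)) plus a nonnegative
   error which is bounded and monotone in p and q, hence eventually constant.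
   This yields the Hilbert polynomials of I, J and {I^rJ^s} without Artin-Rees,
   and l(R/(a', b')) = k^2 l(R/(a, b)) for every joint reduction (a', b') of I^k, J^k.
   Taking U = J^k, V = I^k shows that r(I^k|J^k) = 0 iff
     H(k, k) = k^2 l(R/(a, b)) + H(k, 0) + H(0, k),
   which for large k reads
     (e_1(I) + e_1(J) - e_(1,0) - e_(0,1)) k = e_2(I) + e_2(J) - e_2(IJ).
   If this holds for two values of k, both sides vanish identically; nonnegativity
   of the length of ((U : b^k) cap (V : a^k)) / I^r with U = I^rJ^k and V = I^(r+k)
   gives e_(1,0) <= e_1(I), and symmetrically for J, so both are equalities.
   Joint reductions exist by a bigraded version of the Eakin-Sathaye theorem, as
   I^rJ^s needs at most linearly many generators. *)
From HB Require Import structures.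
Require Import Defs.
From mathcomp Require Import all_boot all_algebra.
From mathcomp Require Import boolp classical_sets cardinality.
From mathcomp Require Import zify ring.
Import GRing.Theory.
Set Implicit Arguments.
Unset Strict Implicit.
Unset Printing Implicit Defensive.
Local Open Scope ring_scope.

(** * Ideal arithmetic *)

Section IdealArithmetic.
Variable R : comNzRingType.
Implicit Types (A B C D K L U V : ideal R) (a b c x y z : R).

(** Function extensionality and proof irrelevance turn [=i] into Leibniz equality, so that
    identities between ideals can be used for rewriting. *)
Lemma ideal_ext A B : A =i B -> A = B.
Proof.
case: A B => [p pP] [q qP] /= epq.
have {}epq : p = q by apply: funext => x; apply: epq.
by case: _ / epq in qP *; congr Submodule; apply: Prop_irrelevance.
Qed.

Lemma ideal_eq A B : {subset A <= B} -> {subset B <= A} -> A = B.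
Proof. by move=> sAB sBA; apply: ideal_ext => x; apply/idP/idP => [/sAB|/sBA]. Qed.

Lemma ideal_mem0 A : (0 : R) \in A. Proof. exact: (rpred0 A). Qed.
Lemma ideal_memD A x y : x \in A -> y \in A -> x + y \in A.
Proof. exact: (@rpredD _ A). Qed.
Lemma ideal_memM A x y : y \in A -> x * y \in A.
Proof. exact: (@rpredZ _ _ A x y). Qed.
Lemma ideal_memMr A x y : x \in A -> x * y \in A.
Proof. by rewrite mulrC; apply: ideal_memM. Qed.
Lemma ideal_memN A x : x \in A -> - x \in A.
Proof. by move=> xA; rewrite -mulN1r ideal_memM. Qed.
Lemma ideal_memB A x y : x \in A -> y \in A -> x - y \in A.
Proof. by move=> xA yA; rewrite ideal_memD ?ideal_memN. Qed.
Lemma ideal_mem_sum A n (F : 'I_n -> R) :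
  (forall i, F i \in A) -> \sum_i F i \in A.
Proof. by move=> FA; apply: (@rpred_sum _ A) => i _; apply: FA. Qed.

Lemma sub_ideal1 A : {subset A <= ideal1 R}. Proof. by []. Qed.

Lemma addIP A B x :
  reflect (exists y z, [/\ y \in A, z \in B & x = y + z]) (x \in (A + B)%I).
Proof. exact: asboolP. Qed.
Lemma mulIP A B x :
  reflect (exists n (y z : 'I_n -> R^o),
    [/\ forall i, y i \in A, forall i, z i \in B & x = \sum_i y i * z i])
    (x \in (A * B)%I).
Proof. exact: asboolP. Qed.
Lemma scaleIP a A x : reflect (exists2 y, y \in A & x = a * y) (x \in (a *: A)%I).
Proof. exact: asboolP. Qed.

Lemma mem_addI A B x y : x \in A -> y \in B -> x + y \in (A + B)%I.
Proof. by move=> xA yB; apply/addIP; exists x, y. Qed.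
Lemma mem_addIl A B : {subset A <= (A + B)%I}.
Proof. by move=> x xA; rewrite -[x]addr0 mem_addI ?ideal_mem0. Qed.
Lemma mem_addIr A B : {subset B <= (A + B)%I}.
Proof. by move=> x xA; rewrite -[x]add0r mem_addI ?ideal_mem0. Qed.
Lemma addI_sub A B C :
  {subset A <= C} -> {subset B <= C} -> {subset (A + B)%I <= C}.
Proof. by move=> sAC sBC _ /addIP[y [z [/sAC yA /sBC zB ->]]]; apply: ideal_memD. Qed.
Lemma addIS A B C D :
  {subset A <= C} -> {subset B <= D} -> {subset (A + B)%I <= (C + D)%I}.
Proof.
by move=> sAC sBD; apply: addI_sub => x => [/sAC|/sBD]; [apply: mem_addIl|apply: mem_addIr].
Qed.

Lemma mem_mulI A B x y : x \in A -> y \in B -> x * y \in (A * B)%I.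
Proof.
move=> xA yB; apply/mulIP; exists 1%N, (fun=> x), (fun=> y).
by split=> //; rewrite big_ord1.
Qed.
Lemma mulI_sub A B C :
  (forall x y, x \in A -> y \in B -> x * y \in C) -> {subset (A * B)%I <= C}.
Proof.
by move=> sABC _ /mulIP[n [y [z [yA zB ->]]]]; apply: ideal_mem_sum => i; apply: sABC.
Qed.
Lemma mulIS A B C D :
  {subset A <= C} -> {subset B <= D} -> {subset (A * B)%I <= (C * D)%I}.
Proof. by move=> sAC sBD; apply: mulI_sub => x y /sAC ? /sBD ?; apply: mem_mulI. Qed.
Lemma mulI_subl A B : {subset (A * B)%I <= A}.
Proof. by apply: mulI_sub => x y xA _; apply: ideal_memMr. Qed.
Lemma mulI_subr A B : {subset (A * B)%I <= B}.
Proof. by apply: mulI_sub => x y _ yB; apply: ideal_memM. Qed.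

Lemma mem_scaleI a A x : x \in A -> a * x \in (a *: A)%I.
Proof. by move=> xA; apply/scaleIP; exists x. Qed.
Lemma scaleI_sub a A C :
  (forall x, x \in A -> a * x \in C) -> {subset (a *: A)%I <= C}.
Proof. by move=> sAC _ /scaleIP[x xA ->]; apply: sAC. Qed.
Lemma scaleIS a A B : {subset A <= B} -> {subset (a *: A)%I <= (a *: B)%I}.
Proof. by move=> sAB; apply: scaleI_sub => x /sAB; apply: mem_scaleI. Qed.
Lemma scaleI_subid a A : {subset (a *: A)%I <= A}.
Proof. by apply: scaleI_sub => x; apply: ideal_memM. Qed.
Lemma scaleI_mul a A B : a \in A -> {subset (a *: B)%I <= (A * B)%I}.
Proof. by move=> aA; apply: scaleI_sub => x xB; apply: mem_mulI. Qed.

Lemma mulIC A B : (A * B = B * A)%I.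
Proof.
by apply: ideal_eq; apply: mulI_sub => x y ? ?; rewrite mulrC mem_mulI.
Qed.
Lemma mulIDr A B C : (A * (B + C) = A * B + A * C)%I.
Proof.
apply: ideal_eq.
  apply: mulI_sub => x _ xA /addIP[y [z [yB zC ->]]].
  by rewrite mulrDr mem_addI ?mem_mulI.
by apply: addI_sub; apply: mulIS => //; [apply: mem_addIl|apply: mem_addIr].
Qed.
Lemma scaleIM a A B : (a *: (A * B) = (a *: A) * B)%I.
Proof.
apply: ideal_eq.
  apply: scaleI_sub => _ /mulIP[n [y [z [yA zB ->]]]].
  rewrite mulr_sumr; apply: ideal_mem_sum => i.
  by rewrite mulrA mem_mulI ?mem_scaleI.
by apply: mulI_sub => _ z /scaleIP[y yA ->] zB; rewrite -mulrA mem_scaleI ?mem_mulI.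
Qed.
Lemma mulIA A B C : (A * (B * C) = A * B * C)%I.
Proof.
suff sub A' B' C' : {subset (A' * (B' * C'))%I <= (A' * B' * C')%I}.
  apply: ideal_eq; [exact: sub|].
  rewrite (mulIC (A * B)%I) (mulIC A B) (mulIC A (B * C)%I) (mulIC B C).
  exact: sub.
apply: mulI_sub => x _ xA /mulIP[n [y [z [yB zC ->]]]].
rewrite mulr_sumr; apply: ideal_mem_sum => i.
by rewrite mulrA !mem_mulI.
Qed.
Lemma mul1I A : (ideal1 R * A = A)%I.
Proof.
apply: ideal_eq; first exact: mulI_subr.
by move=> x xA; rewrite -[x]mul1r mem_mulI.
Qed.
HB.instance Definition _ :=
  Monoid.isComLaw.Build (ideal R) (ideal1 R) (@mulI R) mulIA mulIC mul1I.

Lemma mulI1 A : (A * ideal1 R = A)%I. Proof. exact: Monoid.mulm1. Qed.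
Lemma mulICA A B C : (A * (B * C) = B * (A * C))%I. Proof. exact: Monoid.mulmCA. Qed.
Lemma mulIACA A B C D : (A * B * (C * D) = A * C * (B * D))%I.
Proof. exact: Monoid.mulmACA. Qed.
Lemma mulIDl A B C : ((B + C) * A = B * A + C * A)%I.
Proof. by rewrite mulIC mulIDr !(mulIC A). Qed.
Lemma scaleI_mull a A B : (a *: (A * B) = A * (a *: B))%I.
Proof. by rewrite (mulIC A) scaleIM mulIC. Qed.

Lemma scaleIA a b A : (a *: (b *: A) = (a * b) *: A)%I.
Proof.
apply: ideal_eq; apply: scaleI_sub => x.
  by move=> /scaleIP[y yA ->]; rewrite mulrA mem_scaleI.
by move=> xA; rewrite -mulrA !mem_scaleI.
Qed.
Lemma scale1I A : (1 *: A = A)%I.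
Proof.
apply: ideal_eq; first exact: scaleI_subid.
by move=> x xA; rewrite -[x]mul1r mem_scaleI.
Qed.
Lemma scaleIDr a A B : (a *: (A + B) = a *: A + a *: B)%I.
Proof.
apply: ideal_eq.
  by apply: scaleI_sub => _ /addIP[y [z [yA zB ->]]]; rewrite mulrDr mem_addI ?mem_scaleI.
by apply: addI_sub; apply: scaleIS; [apply: mem_addIl|apply: mem_addIr].
Qed.

Lemma addIC A B : (A + B = B + A)%I.
Proof.
by apply: ideal_eq; apply: addI_sub; by [apply: mem_addIl|apply: mem_addIr].
Qed.
Lemma addI_idPr A B : {subset A <= B} -> (A + B = B)%I.
Proof. by move=> sAB; apply: ideal_eq; [apply: addI_sub|apply: mem_addIr]. Qed.

Lemma expIS A n : (A ^+ n.+1 = A * A ^+ n)%I. Proof. by []. Qed.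
Lemma expI0 A : (A ^+ 0 = ideal1 R)%I. Proof. by []. Qed.
Lemma expI1 A : (A ^+ 1 = A)%I. Proof. exact: mulI1. Qed.
Lemma expID A n p : (A ^+ (n + p) = A ^+ n * A ^+ p)%I.
Proof. by elim: n => [|n IHn]; rewrite ?mul1I // addSn !expIS IHn mulIA. Qed.
Lemma expIM A n p : (A ^+ (n * p) = (A ^+ n) ^+ p)%I.
Proof. by elim: p => [|p IHp]; rewrite ?muln0 // mulnS expID IHp. Qed.
Lemma expIMn A B n : ((A * B) ^+ n = A ^+ n * B ^+ n)%I.
Proof. by elim: n => [|n IHn]; rewrite ?mul1I // !expIS IHn mulIACA. Qed.
Lemma mem_expI A a n : a \in A -> a ^+ n \in (A ^+ n)%I.
Proof. by move=> aA; elim: n => // n IHn; rewrite exprS mem_mulI. Qed.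

(** A product of p + q factors from A or B has p factors from A or q from B. The double induction
    splits off one factor and uses the hypothesis that accounts for it. *)
Lemma expI_add_sub A B p q :
  {subset ((A + B) ^+ (p + q))%I <= (A ^+ p + B ^+ q)%I}.
Proof.
elim: p q => [|p IHp] q; first by move=> x _; apply: mem_addIl.
elim: q => [|q IHq]; first by move=> x _; apply: mem_addIr.
rewrite addSn expIS mulIDl; apply: addI_sub => x.
  move/(mulIS (fun _ => id) (IHp q.+1)); rewrite mulIDr; move: x.
  by apply: addIS => //; apply: mulI_subr.
rewrite addnS -addSn; move/(mulIS (fun _ => id) IHq); rewrite mulIDr; move: x.
by apply: addIS => //; apply: mulI_subr.
Qed.

Definition colonI_pred K a : {pred R^o} := fun x => a * x \in K.
Fact colonI_closed K a : submod_closed (colonI_pred K a).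
Proof.
split=> [|c x y xK yK]; rewrite unfold_in ?mulr0 ?ideal_mem0 // mulrDr.
by rewrite ideal_memD // [c *: _]/(c * _) mulrCA ideal_memM.
Qed.
Definition colonI K a : ideal R := Submodule (colonI_closed K a).

Definition capI_pred A B : {pred R^o} := fun x => (x \in A) && (x \in B).
Fact capI_closed A B : submod_closed (capI_pred A B).
Proof.
split=> [|c x y /andP[xA xB] /andP[yA yB]]; rewrite unfold_in ?ideal_mem0 //.
by rewrite !ideal_memD // [c *: _]/(c * _) ideal_memM.
Qed.
Definition capI A B : ideal R := Submodule (capI_closed A B).

Lemma mem_colonI K a x : (x \in colonI K a) = (a * x \in K). Proof. by []. Qed.
Lemma mem_capI A B x : (x \in capI A B) = (x \in A) && (x \in B). Proof. by []. Qed.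
Lemma sub_colonI K a : {subset K <= colonI K a}.
Proof. by move=> x xK; rewrite mem_colonI ideal_memM. Qed.

Definition principal a : ideal R := (a *: ideal1 R)%I.
Definition pairI a b : ideal R := (principal a + principal b)%I.

Lemma mem_principal a x : reflect (exists y, x = a * y) (x \in principal a).
Proof.
by apply: (iffP (scaleIP _ _ _)) => [[y _]|[y]] ->; exists y.
Qed.
Lemma principal_id a : a \in principal a.
Proof. by apply/mem_principal; exists 1; rewrite mulr1. Qed.
Lemma principal_sub a A : a \in A -> {subset principal a <= A}.
Proof. by move=> aA _ /mem_principal[y ->]; apply: ideal_memMr. Qed.
Lemma pairI_sub a b A : a \in A -> b \in A -> {subset pairI a b <= A}.
Proof. by move=> aA bA; apply: addI_sub; apply: principal_sub. Qed.
Lemma pairI_l a b : a \in pairI a b.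
Proof. exact/mem_addIl/principal_id. Qed.
Lemma pairI_r a b : b \in pairI a b.
Proof. exact/mem_addIr/principal_id. Qed.
Lemma pairIC a b : pairI a b = pairI b a. Proof. exact: addIC. Qed.
Lemma pairIP a b x : reflect (exists y z, x = a * y + b * z) (x \in pairI a b).
Proof.
apply: (iffP (addIP _ _ _)) => [[_ [_ [/mem_principal[y ->] /mem_principal[z ->] ->]]]|].
  by exists y, z.
by move=> [y [z ->]]; exists (a * y), (b * z); split=> //; apply/mem_principal; [exists y|exists z].
Qed.

Definition zeroI : ideal R := principal 0.
Lemma mem_zeroI x : (x \in zeroI) = (x == 0).
Proof.
by apply/mem_principal/eqP => [[y ->]|->]; [rewrite mul0r|exists 0; rewrite mul0r].
Qed.

End IdealArithmetic.

(** * Chains of ideals and lengths *)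

Lemma is_max_unique (P : nat -> Prop) n p : is_max P n -> is_max P p -> n = p.
Proof. by case=> Pn le_n [Pp le_p]; apply/eqP; rewrite eqn_leq le_p ?le_n. Qed.

Section Chains.
Variable R : comNzRingType.
Implicit Types (A B C D K L U V : ideal R) (a b c x y z : R).

(** Only the top member is fixed; the bottom one merely contains A. Hence both ends of a chain can
    be moved outwards without changing its length. *)
Inductive ideal_chain A : ideal R -> nat -> Prop :=
| ideal_chain0 B : {subset A <= B} -> ideal_chain A B 0
| ideal_chainS B C n : ideal_chain A B n -> Defs.proper_sub B C -> ideal_chain A C n.+1.

Lemma ideal_chain_sub A B n : ideal_chain A B n -> {subset A <= B}.
Proof.
by elim=> {B n} [//|B C n _ sAB [sBC _]] x /sAB/sBC.
Qed.

Lemma proper_subS A B C :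
  Defs.proper_sub A B -> {subset B <= C} -> Defs.proper_sub A C.
Proof.
by move=> [sAB nBA] sBC; split=> [x /sAB/sBC //|sCA]; apply: nBA => x /sBC/sCA.
Qed.

Lemma ideal_chain_widen A B C n :
  ideal_chain A B n -> {subset B <= C} -> ideal_chain A C n.
Proof.
case=> {B n} [B sAB sBC|B D n ch pBD sDC]; first by apply: ideal_chain0 => x /sAB/sBC.
by apply: ideal_chainS ch _; apply: proper_subS sDC.
Qed.

Lemma ideal_chain_weaken A A' B n :
  {subset A' <= A} -> ideal_chain A B n -> ideal_chain A' B n.
Proof.
move=> sA; elim=> {B n} [B sAB|B C n _ IH pBC]; last exact: ideal_chainS IH pBC.
by apply: ideal_chain0 => x /sA/sAB.
Qed.

Lemma ideal_chain_cat A B C p q :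
  ideal_chain A B p -> ideal_chain B C q -> ideal_chain A C (p + q).
Proof.
move=> chAB; elim=> {C q} [C sBC|D C q _ IH pDC].
  by rewrite addn0; apply: ideal_chain_widen sBC.
by rewrite addnS; apply: ideal_chainS IH pDC.
Qed.

Lemma ideal_chain_step A B C n :
  ideal_chain A B n -> {subset B <= C} ->
  ideal_chain A C n.+1 \/ {subset C <= B}.
Proof.
move=> ch sBC; case: (EM {subset C <= B}) => [|nCB]; [by right|left].
exact: ideal_chainS ch (conj sBC nCB).
Qed.

(** By the modular law a strict inclusion of D in D' stays strict after intersecting with B or after
    adding B, so every step of the chain survives on one of the two sides. This yields the
    additivity of length. *)
Lemma ideal_chain_split A B D n : {subset A <= B} -> ideal_chain A D n ->
  exists p q, [/\ (n <= p + q)%N, ideal_chain A (capI D B) p &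
    ideal_chain B (D + B)%I q].
Proof.
move=> sAB; elim=> {D n} [D sAD|D D' n _ [p [q [le_n chp chq]]] [sD nD]].
  exists 0%N, 0%N; split=> //; apply: ideal_chain0 => x; last exact: mem_addIr.
  by move=> xA; rewrite mem_capI sAD ?sAB.
have scap : {subset capI D B <= capI D' B}.
  by move=> x; rewrite !mem_capI => /andP[/sD -> ->].
have sadd : {subset (D + B)%I <= (D' + B)%I} by apply: addIS.
case: (ideal_chain_step chp scap) => [chp'|ncap].
  exists p.+1, q; split=> //; exact: ideal_chain_widen chq sadd.
case: (ideal_chain_step chq sadd) => [chq'|nadd].
  exists p, q.+1; split=> //; first by rewrite addnS.
  exact: ideal_chain_widen chp scap.
case: nD => z zD'; have /addIP[d [b [dD bB zE]]] : z \in (D + B)%I.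
  by apply/nadd/mem_addIl.
have bD : b \in capI D B.
  have bE : b = z - d by rewrite zE addrC addKr.
  by apply: ncap; rewrite mem_capI bB andbT bE; apply: ideal_memB => //; apply: sD.
by rewrite zE ideal_memD //; case/andP: bD.
Qed.

Lemma ideal_chain_max_add A B C p q :
  {subset A <= B} -> {subset B <= C} ->
  is_max (ideal_chain A B) p -> is_max (ideal_chain B C) q ->
  is_max (ideal_chain A C) (p + q).
Proof.
move=> sAB sBC [chp maxp] [chq maxq]; split; first exact: ideal_chain_cat chp chq.
move=> n /(ideal_chain_split sAB)[p' [q' [le_n chp' chq']]].
apply: leq_trans le_n _; apply: leq_add.
  by apply/maxp/(ideal_chain_widen chp') => x /andP[].
by apply/maxq/(ideal_chain_widen chq'); apply: addI_sub.
Qed.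

(* Multiplication by b induces an isomorphism L / (L cap (U : b)) ~ (bL + U) / U. *)
Lemma ideal_chain_mul b L U D n :
  ideal_chain (capI L (colonI U b)) D n -> {subset D <= L} ->
  ideal_chain U (b *: D + U)%I n.
Proof.
elim=> {D n} [D sD sDL|D D' n ch IH [sD nD] sDL].
  by apply: ideal_chain0; apply: mem_addIr.
apply: ideal_chainS (IH _) _ => [x /sD/sDL //|]; split.
  by apply: addIS => //; apply: scaleIS.
move=> sub; apply: nD => z zD'.
have /sub/addIP[_ [u [/scaleIP[d dD ->] uU E]]] : b * z \in (b *: D' + U)%I.
  exact/mem_addIl/mem_scaleI.
rewrite -(subrK d z) ideal_memD //; apply: (ideal_chain_sub ch).
rewrite mem_capI; apply/andP; split; first by apply: ideal_memB; apply: sDL => //; apply: sD.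
by rewrite mem_colonI mulrBr E addrC addKr.
Qed.

(** The inverse correspondence. Pulling back along multiplication by b keeps inclusions strict,
    since every element of bL + U is modulo U a multiple bl with l in L. *)
Lemma ideal_chain_colon b L U D n :
  ideal_chain U D n -> {subset D <= (b *: L + U)%I} ->
  ideal_chain (capI L (colonI U b)) (capI L (colonI D b)) n.
Proof.
elim=> {D n} [D sUD sD|D D' n ch IH [sD nD] sD'].
  by apply: ideal_chain0 => x; rewrite !mem_capI !mem_colonI => /andP[-> /sUD].
apply: ideal_chainS (IH _) _ => [x /sD/sD' //|]; split=> [x|sub].
  by rewrite !mem_capI !mem_colonI => /andP[-> /sD].
have sUD := ideal_chain_sub ch.
apply: nD => z zD'; have /addIP[_ [u [/scaleIP[l lL ->] /sUD uD E]]] := sD' _ zD'.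
rewrite E ideal_memD //; have /sub/andP[] // : l \in capI L (colonI D' b).
by rewrite mem_capI lL mem_colonI -(addrK u (b * l)) -E; apply: ideal_memB => //; apply: sD.
Qed.

Lemma ideal_chain_max_mul b L U n :
  is_max (ideal_chain U (b *: L + U)%I) n <->
  is_max (ideal_chain (capI L (colonI U b)) L) n.
Proof.
have sL : {subset capI L (colonI (b *: L + U)%I b) <= L} by move=> x /andP[].
split=> [] [ch maxn]; split.
- by apply: ideal_chain_widen (ideal_chain_colon ch _) sL.
- by move=> p ch'; apply/maxn/(ideal_chain_mul ch').
- exact: ideal_chain_mul ch _.
- move=> p ch'; apply: maxn; apply: ideal_chain_widen sL.
  exact: ideal_chain_colon ch' _.
Qed.

Lemma ideal_chain_max_subl A A' B N :
  {subset A <= A'} -> {subset A' <= B} ->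
  (forall n, ideal_chain A B n -> (n <= N)%N) ->
  exists n, is_max (ideal_chain A' B) n.
Proof.
move=> sA sA'B bound.
have exP : exists n, `[<ideal_chain A' B n>] by exists 0%N; apply/asboolP/ideal_chain0.
have ub n : `[<ideal_chain A' B n>] -> (n <= N)%N.
  by move=> /asboolP/(ideal_chain_weaken sA); apply: bound.
case: (ex_maxnP exP ub) => n /asboolP ch maxn; exists n; split=> // p chp.
exact/maxn/asboolP.
Qed.

Lemma ideal_chain_fun A B n : ideal_chain A B n ->
  exists C : nat -> ideal R, [/\ forall i, (i < n)%N -> Defs.proper_sub (C i) (C i.+1),
    C n = B & forall i, (i <= n)%N -> {subset A <= C i}].
Proof.
elim=> {B n} [B sAB|B D n ch [C [pC Cn sC]] pBD].
  by exists (fun=> B); split.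
exists (fun i => if (i <= n)%N then C i else D); split=> [i|| i _].
- rewrite ltnS => le_in; rewrite le_in; case: ltnP => [|ge_in]; first exact: pC.
  by have -> : i = n; [apply/eqP; rewrite eqn_leq le_in|rewrite Cn].
- by rewrite ltnn.
- case: leqP => [|_ x xA]; first exact: sC.
  by apply: (proj1 pBD); apply: (ideal_chain_sub ch).
Qed.

Lemma ideal_chain_of_fun A n (C : nat -> ideal R) :
  (forall i, (i < n)%N -> Defs.proper_sub (C i) (C i.+1)) -> {subset A <= C 0%N} ->
  ideal_chain A (C n) n.
Proof.
elim: n => [|n IHn] pC sA; first exact: ideal_chain0.
by apply: ideal_chainS (IHn _ sA) (pC _ _) => // i lt_in; apply/pC/ltnW.
Qed.

Section QuotientChains.
Variable K : ideal R.
Local Notation Q := {ideal_quot K}.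
Local Notation pr := (\pi_Q : R^o -> Q)%qT.

Lemma pi_eq x y : (pr x == pr y) = (x - y \in K).
Proof. by rewrite (Quotient.idealrBE K x y). Qed.

Lemma pi_add x y : pr (x + y) = pr x + pr y. Proof. exact: raddfD. Qed.
Lemma pi_scale x y : pr (x *: (y : R^o)) = x *: pr y.
Proof. by rewrite -[LHS]pi_quot_scale. Qed.
Lemma pi_zero : pr 0 = 0. Proof. exact: raddf0. Qed.

(** The image of D in R/K. Adding K makes the test on [repr q] independent of the representative. *)
Definition quot_image_pred D : {pred Q} := fun q => (repr q : R) \in (K + D)%I.
Lemma mem_quot_image D x : (pr x \in quot_image_pred D) = (x \in (K + D)%I).
Proof.
have dD : repr (pr x) - x \in (K + D)%I.
  by apply: mem_addIl; rewrite -pi_eq reprK.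
rewrite unfold_in; apply/idP/idP => h.
  by rewrite -(subKr (repr (pr x)) x) ideal_memB.
by rewrite -(subrK x (repr (pr x))) ideal_memD.
Qed.
Fact quot_image_closed D : submod_closed (quot_image_pred D).
Proof.
split=> [|a p q]; first by rewrite -pi_zero mem_quot_image ideal_mem0.
rewrite -[p]reprK -[q]reprK -pi_scale -pi_add !mem_quot_image => pD qD.
by rewrite ideal_memD // [_ *: _]/(a * _) ideal_memM.
Qed.
Definition quot_image D := Submodule (quot_image_closed D).

Definition quot_preim_pred (C : submodule Q) : {pred R^o} := fun x => pr x \in C.
Fact quot_preim_closed (C : submodule Q) : submod_closed (quot_preim_pred C).
Proof.
split=> [|a x y xC yC]; first by rewrite unfold_in pi_zero (rpred0 C).
by rewrite unfold_in pi_add pi_scale (rpredD (rpredZ a xC) yC).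
Qed.
Definition quot_preim (C : submodule Q) : ideal R := Submodule (quot_preim_closed C).

(** The correspondence between ideals above K and submodules of R/K: images of a chain above K stay
    strict, and preimages of submodules contain K. *)
Lemma module_length_quot l :
  is_max (ideal_chain K (ideal1 R)) l -> module_length Q l.
Proof.
case=> ch maxl; split.
  have [C [pC _ sC]] := ideal_chain_fun ch.
  exists (fun i => quot_image (C i)) => i lt_il; have [sCi nCi] := pC i lt_il.
  split=> [q|sub].
    rewrite -[q]reprK !mem_quot_image; exact: addIS.
  apply: nCi => x xC; have /sub : pr x \in quot_image (C i.+1).
    by rewrite mem_quot_image; apply: mem_addIr.
  by rewrite mem_quot_image addI_idPr //; apply/sC/ltnW.
move=> n [C pC]; apply: maxl.
apply: (@ideal_chain_widen _ (quot_preim (C n))) => //.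
apply: (@ideal_chain_of_fun _ _ (fun i => quot_preim (C i))) => [i /pC[sCi nCi]|x xK].
  split=> [x /sCi //|sub]; apply: nCi => q; rewrite -[q]reprK; exact: sub.
have -> : (x \in quot_preim (C 0%N)) = (pr x \in C 0%N) by [].
suff -> : pr x = 0 by apply: (rpred0 (C 0%N)).
by apply/eqP; rewrite -pi_zero pi_eq subr0.
Qed.
End QuotientChains.

End Chains.

(** * Prime ideals avoiding multiplicative sets *)

Section IdealsAvoiding.
Variable R : comNzRingType.
Implicit Types (A B C D K L U V P : ideal R) (a b c x y z : R) (S : R -> Prop).

Definition avoids S A := forall x, x \in A -> ~ S x.

(* Zorn's lemma is applied to membership functions R -> bool and not to the
   type [ideal R], which lives in too large a universe. *)
Lemma maximal_avoiding S A : avoids S A ->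
  exists P, [/\ {subset A <= P}, avoids S P &
    forall P', {subset P <= P'} -> avoids S P' -> {subset P' <= P}].
Proof.
move=> avA.
pose good (f : R -> bool) :=
  exists P, [/\ {subset A <= P}, avoids S P & forall x, (x \in P) = f x].
pose T := {f : R -> bool | good f}.
have goodP P : {subset A <= P} -> avoids S P -> good (fun x => x \in P).
  by exists P.
pose le (f g : T) := `[<forall x, sval f x -> sval g x>].
have leP (f g : T) : reflect (forall x, sval f x -> sval g x) (le f g).
  exact: asboolP.
have [] := @ZL_preorder T (exist _ _ (goodP A (fun _ => id) avA)) le.
- by move=> f; apply/leP.
- by move=> f g h /leP s12 /leP s23; apply/leP => x /s12/s23.
- move=> F totF.
  (* The union of the chain; A is thrown in to cover the empty chain. *)
  pose un_pred : {pred R^o} :=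
    fun x => `[< x \in A \/ exists2 f : T, F f & sval f x >].
  have memD (f : T) (c x y : R) : sval f x -> sval f y -> sval f (c * x + y).
    have [P [_ _ eP]] := svalP f; rewrite -!eP => xP yP.
    by rewrite ideal_memD ?ideal_memM.
  have memA (f : T) x : x \in A -> sval f x.
    by have [P [sAP _ <-]] := svalP f; apply: sAP.
  have un_closed : submod_closed un_pred.
    split; first by apply/asboolP; left; rewrite ideal_mem0.
    move=> c x y /asboolP[xA|[f Ff xf]] /asboolP[yA|[g Fg yg]]; apply/asboolP.
    + by left; apply: ideal_memD => //; apply: ideal_memM.
    + by right; exists g => //; apply: memD => //; apply: memA.
    + by right; exists f => //; apply: memD => //; apply: memA.
    + right; have [/leP sfg|/leP sgf] := totF _ _ Ff Fg.
        by exists g => //; apply: memD => //; apply: sfg.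
      by exists f => //; apply: memD => //; apply: sgf.
  have sAU : {subset A <= Submodule un_closed} by move=> x xA; apply/asboolP; left.
  have avU : avoids S (Submodule un_closed).
    move=> x /asboolP[/avA //|[f _]].
    by have [P [_ avP <-]] := svalP f; apply: avP.
  exists (exist _ _ (goodP _ sAU avU)) => f Ff; apply/leP => x xf /=.
  by apply/asboolP; right; exists f.
move=> f maxf; have [P [sAP avP eP]] := svalP f; exists P; split=> //.
move=> P' sPP' avP' x xP'; have sAP' : {subset A <= P'} by move=> y /sAP/sPP'.
pose g : T := exist _ _ (goodP _ sAP' avP').
have /maxf/leP sgf : le f g by apply/leP => y; rewrite -eP; apply: sPP'.
by rewrite eP; apply: sgf.
Qed.

(** A maximal ideal P among those avoiding S is prime: if u and v lie outside P, then P + (u) and P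
    + (v) meet S, and the product of the two elements found is in S and, when uv is in P, also in
    P. *)
Lemma prime_avoiding S A :
  S 1 -> (forall x y, S x -> S y -> S (x * y)) -> avoids S A ->
  exists P, [/\ {subset A <= P}, avoids S P & prime_ideal P].
Proof.
move=> S1 SM /maximal_avoiding[P [sAP avP maxP]]; exists P; split=> //.
have meets u : u \notin P -> exists p r, p \in P /\ S (p + u * r).
  move=> uP; apply: contrapT => noS; case/negP: uP.
  apply: (maxP (P + principal u)%I); first exact: mem_addIl.
    move=> _ /addIP[p [_ [pP /mem_principal[r ->] ->]]] Spr.
    by apply: noS; exists p, r.
  exact/mem_addIr/principal_id.
split; first by apply/negP => /avP.
move=> u v uvP; apply: contrapT => /negP; rewrite negb_or.
case/andP=> /meets[p [r [pP Spr]]] /meets[q [t [qP Sqt]]].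
apply: avP (SM _ _ Spr Sqt); rewrite mulrDl (mulrDr (u * r)).
apply: ideal_memD; first exact: ideal_memMr.
by apply: ideal_memD; [apply: ideal_memM|rewrite mulrACA ideal_memMr].
Qed.

Definition nonzerodivisor_mod A x := forall z, x * z \in A -> z \in A.

Lemma nonzerodivisor_modX A x n :
  nonzerodivisor_mod A x -> nonzerodivisor_mod A (x ^+ n).
Proof.
move=> xA; elim: n => [|n IHn] z; first by rewrite mul1r.
by rewrite exprS -mulrA => /xA/IHn.
Qed.

(** The products s x^n with s outside P form a multiplicative set that misses A, because x can be
    cancelled modulo A. A prime avoiding this set lies inside P and omits x. *)
Lemma prime_below A P x :
  nonzerodivisor_mod A x -> prime_ideal P -> {subset A <= P} ->
  exists P', [/\ prime_ideal P', {subset A <= P'}, {subset P' <= P} & x \notin P'].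
Proof.
move=> xA [P1 primeP] sAP.
pose S z := exists s n, s \notin P /\ z = s * x ^+ n.
have S1 : S 1 by exists 1, 0%N; rewrite mul1r.
have SM z t : S z -> S t -> S (z * t).
  move=> [s [n [sP ->]]] [s' [n' [sP' ->]]].
  exists (s * s'), (n + n')%N; rewrite exprD mulrACA; split=> //.
  by apply/negP => /primeP; rewrite (negPf sP) (negPf sP').
have [|P' [sAP' avP' pP']] := prime_avoiding S1 SM (A := A).
  move=> z zA [s [n [sP Dz]]]; case/negP: sP; apply: sAP.
  by apply: (nonzerodivisor_modX xA (n := n)); rewrite mulrC -Dz.
exists P'; split=> // [z zP'|]; last first.
  by apply/negP => /avP'; apply; exists 1, 1%N; rewrite mul1r.
apply: contrapT => /negP zP; apply: (avP' z zP'); exists z, 0%N.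
by rewrite mulr1.
Qed.

End IdealsAvoiding.

(** * Finitely generated ideals *)

Section Span.
Variable R : comNzRingType.
Implicit Types (A B C D K L U V P : ideal R) (a b c x y z : R) (s : seq R).

(** The ideal described by [generated], in a recursive form suited to induction on the list. *)
Definition spanI s : ideal R := foldr (fun x A => principal x + A)%I (zeroI R) s.

Lemma generated_span s x : generated s x <-> x \in spanI s.
Proof.
elim: s x => [|y s IHs] x.
  rewrite mem_zeroI; split=> [[c ->]|/eqP ->]; first by rewrite big_ord0.
  by exists (fun=> 0); rewrite big_ord0.
split=> [[c ->]|/addIP[_ [z [/mem_principal[t ->] /IHs[c ->] ->]]]].
  rewrite big_ord_recl; apply: mem_addI; first by rewrite mulrC ideal_memMr ?principal_id.
  by apply/IHs; exists (fun i => c (lift ord0 i)).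
exists (fun i => if unlift ord0 i is Some j then c j else t).
rewrite big_ord_recl unlift_none mulrC; congr (_ + _).
by apply: eq_bigr => i _; rewrite liftK.
Qed.

Lemma noetherian_span : noetherian R -> forall A, exists s, A = spanI s.
Proof.
move=> noethR A; have [s gen_s] := noethR A.
by exists s; apply: ideal_eq => x; rewrite gen_s generated_span.
Qed.

Lemma spanI_mem s x : x \in s -> x \in spanI s.
Proof.
elim: s => // y s IHs; rewrite inE => /orP[/eqP ->|/IHs xs].
  exact/mem_addIl/principal_id.
exact: mem_addIr.
Qed.

Lemma principal_exp x n : (principal x ^+ n = principal (x ^+ n))%I.
Proof.
elim: n => [|n IHn]; first by rewrite /principal scale1I.
by rewrite expIS IHn /principal -scaleIM mul1I scaleIA -exprS.
Qed.

Lemma spanI_exp_sub s A : (forall x, x \in s -> exists n, x ^+ n \in A) ->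
  exists n, {subset (spanI s ^+ n)%I <= A}.
Proof.
elim: s => [_|x s IHs powA].
  exists 1%N => y; rewrite expI1 mem_zeroI => /eqP ->; exact: ideal_mem0.
have [p xpA] := powA x (mem_head _ _).
have [|q sqA] := IHs; first by move=> y ys; apply: powA; rewrite inE ys orbT.
exists (p + q)%N => y /expI_add_sub; move: y; apply: addI_sub => //.
by rewrite principal_exp; apply: principal_sub.
Qed.

End Span.

(** * Lengths of quotients of a Noetherian local ring *)

Section LocalLength.
Variables (R : comNzRingType) (m : ideal R).
Hypotheses (noethR : noetherian R) (locR : local_ring m).
Implicit Types (A B C D K L U V P : ideal R) (a b c x y z : R).

Lemma local_1 : 1 \notin m. Proof. by case: locR => [[]]. Qed.

Lemma proper_sub_local A : 1 \notin A -> {subset A <= m}.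
Proof.
move=> A1; have [|P [sAP avP maxP]] := @maximal_avoiding _ (fun x => x = 1) A.
  by move=> x xA x1; rewrite -x1 xA in A1.
have P1 : 1 \notin P by apply/negP => /avP.
have maxiP : maximal_ideal P.
  split=> // P' P'1 sPP'; apply: maxP => // x xP' x1.
  by rewrite -x1 xP' in P'1.
by move=> x /sAP; rewrite (proj2 locR P maxiP).
Qed.

Lemma local_unit x : x \notin m -> exists y, x * y = 1.
Proof.
move=> xm; apply: contrapT => noinv; case/negP: xm.
apply: (@proper_sub_local (principal x)); last exact: principal_id.
by apply/negP => /mem_principal[y y1]; apply: noinv; exists y.
Qed.

Lemma local_prime x y : x * y \in m -> x \notin m -> y \in m.
Proof.
move=> xym /local_unit[z xz1]; have -> : y = z * (x * y) by rewrite mulrA (mulrC z) xz1 mul1r.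
exact: ideal_memM.
Qed.

(** The working substitute for being primary to m: it also admits the unit ideal, and it passes to
    larger ideals, products, powers and colons. *)
Definition cofin K := exists n, {subset (m ^+ n)%I <= K}.

Lemma cofinS K L : cofin K -> {subset K <= L} -> cofin L.
Proof. by case=> n sK sKL; exists n => x /sK/sKL. Qed.
Lemma cofin1 : cofin (ideal1 R). Proof. by exists 0%N. Qed.
Lemma cofinM K L : cofin K -> cofin L -> cofin (K * L)%I.
Proof. by case=> n sK [p sL]; exists (n + p)%N; rewrite expID; apply: mulIS. Qed.
Lemma cofin_cap K L : cofin K -> cofin L -> cofin (capI K L).
Proof.
move=> cK cL; apply: cofinS (cofinM cK cL) _ => x xKL.
by rewrite mem_capI (mulI_subl xKL) (mulI_subr xKL).
Qed.
Lemma cofin_colon K a : cofin K -> cofin (colonI K a).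
Proof. by move=> cK; apply: cofinS cK _; apply: sub_colonI. Qed.
Lemma cofinDl K L : cofin K -> cofin (K + L)%I.
Proof. by move=> cK; apply: cofinS cK _; apply: mem_addIl. Qed.
Lemma cofinX K n : cofin K -> cofin (K ^+ n)%I.
Proof. by move=> cK; elim: n => [|n IHn]; [apply: cofin1|apply: cofinM]. Qed.
Lemma cofin_m : cofin m. Proof. by exists 1%N; rewrite expI1. Qed.

Lemma cofin_pow A : (forall x, x \in m -> exists n, x ^+ n \in A) -> cofin A.
Proof.
have [s ms] := noetherian_span noethR m => powA.
have [|n sA] := @spanI_exp_sub _ s A; last by exists n; rewrite ms.
by move=> x /spanI_mem; rewrite -ms => /powA.
Qed.

Lemma ideal_chain_local_le1 n : ideal_chain m (ideal1 R) n -> (n <= 1)%N.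
Proof.
case: n => [|[|n]] // ch; inversion_clear ch as [|B C p ch' pB].
inversion_clear ch' as [|D C p ch pD].
have B1 : 1 \notin B.
  apply/negP => B1; case: pB => _; apply=> x _; rewrite -(mulr1 x); exact: ideal_memM.
case: pD => _ []; move=> x /(proper_sub_local B1); exact: (ideal_chain_sub ch).
Qed.

Lemma ideal_chain_max_refl A : is_max (ideal_chain A A) 0.
Proof.
split=> [|n ch]; first exact: ideal_chain0.
inversion_clear ch as [|B C p ch' pB] => //.
by case: pB => _ []; apply: (ideal_chain_sub ch').
Qed.

(** Adjoining a generator x to U = [spanI s + K] adds a module isomorphic to R/(U : x). Since m lies
    in (U : x), its length is at most 1. *)
Lemma ideal_chain_max_span s K : {subset (m * spanI s)%I <= K} ->
  exists n, is_max (ideal_chain K (spanI s + K)%I) n.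
Proof.
elim: s => [_|x s IHs sK].
  exists 0%N; rewrite (_ : (_ + _)%I = K); first exact: ideal_chain_max_refl.
  by apply: addI_idPr => y; rewrite mem_zeroI => /eqP ->; rewrite ideal_mem0.
have [|n maxn] := IHs.
  by move=> y h; apply: sK; apply: mulIS h => // z; apply: mem_addIr.
have [] : exists n, is_max (ideal_chain (spanI s + K)%I (x *: ideal1 R + (spanI s + K))%I) n.
  have sm : {subset m <= capI (ideal1 R) (colonI (spanI s + K)%I x)}.
    move=> y ym; rewrite mem_capI /= mem_colonI mulrC; apply/mem_addIr/sK.
    exact/mem_mulI/mem_addIl/principal_id.
  have [p maxp] := ideal_chain_max_subl sm (@sub_ideal1 _ _) ideal_chain_local_le1.
  by exists p; apply/ideal_chain_max_mul.
move=> p maxp; exists (n + p)%N.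
have -> : (spanI (x :: s) + K = x *: ideal1 R + (spanI s + K))%I.
  apply: ideal_eq => y.
    move=> /addIP[_ [k [/addIP[y1 [y2 [? ? ->]]] kK ->]]].
    by rewrite -addrA !mem_addI.
  move=> /addIP[y1 [_ [? /addIP[y2 [k [? ? ->]]] ->]]].
  by rewrite addrA !mem_addI.
by apply: ideal_chain_max_add maxn maxp; apply: mem_addIr.
Qed.

(** It suffices to treat the powers of m, where the finite layers between consecutive powers add
    up. *)
Lemma cofin_chain_max K : cofin K -> exists n, is_max (ideal_chain K (ideal1 R)) n.
Proof.
case=> n sK; suff [p [_ maxp]] : exists p, is_max (ideal_chain (m ^+ n)%I (ideal1 R)) p.
  exact: ideal_chain_max_subl sK _ maxp.
elim: n {sK} => [|n [p maxp]]; first by exists 0%N; apply: ideal_chain_max_refl.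
have [s mn] := noetherian_span noethR (m ^+ n)%I.
have [|q maxq] := @ideal_chain_max_span s (m ^+ n.+1)%I; first by rewrite -mn.
exists (q + p)%N; apply: ideal_chain_max_add maxp => //; first exact: mulI_subr.
by rewrite (_ : (m ^+ n)%I = (spanI s + m ^+ n.+1)%I) // addIC -mn addI_idPr //; apply: mulI_subr.
Qed.

(** The length of R/K, with value 0 when chains above K have no greatest length. *)
Definition lam K : nat := xget 0%N [set n | is_max (ideal_chain K (ideal1 R)) n].

Lemma lamP K : cofin K -> is_max (ideal_chain K (ideal1 R)) (lam K).
Proof. by move=> /cofin_chain_max/(xgetPex 0%N). Qed.

Lemma module_length_lam K : cofin K -> module_length {ideal_quot K} (lam K).
Proof. by move/lamP; apply: module_length_quot. Qed.

Lemma lam_split K L : cofin K -> {subset K <= L} ->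
  exists n, is_max (ideal_chain K L) n /\ lam K = (n + lam L)%N.
Proof.
move=> cK sKL; have [chK maxK] := lamP cK.
have exP : exists n, `[<ideal_chain K L n>] by exists 0%N; apply/asboolP/ideal_chain0.
have ub n : `[<ideal_chain K L n>] -> (n <= lam K)%N.
  by move=> /asboolP ch; apply/maxK/(ideal_chain_widen ch).
case: (ex_maxnP exP ub) => n /asboolP ch maxn.
have max_n : is_max (ideal_chain K L) n by split=> // p chp; apply/maxn/asboolP.
exists n; split=> //; apply: is_max_unique (lamP cK) _.
by apply: ideal_chain_max_add max_n (lamP (cofinS cK sKL)).
Qed.

Lemma lam_ideal1 : lam (ideal1 R) = 0%N.
Proof. exact: is_max_unique (lamP cofin1) (ideal_chain_max_refl _). Qed.

Lemma lam_le K L : cofin K -> {subset K <= L} -> (lam L <= lam K)%N.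
Proof. by move=> cK sKL; have [n [_ ->]] := lam_split cK sKL; apply: leq_addl. Qed.

Lemma lam_eq K L : cofin K -> {subset K <= L} -> (lam K <= lam L)%N -> K = L.
Proof.
move=> cK sKL; have [n [[_ maxn] ->]] := lam_split cK sKL => le0.
apply: ideal_eq => //; apply: contrapT => nLK.
have := maxn _ (ideal_chainS (ideal_chain0 (fun _ => id)) (conj sKL nLK)).
lia.
Qed.

(** The isomorphic modules (bL + U)/U and L/(L cap (U : b)) have equal length; the equation says so
    without subtraction. *)
Lemma lam_mul b U L : cofin U -> cofin L ->
  (lam U + lam L = lam (b *: L + U)%I + lam (capI L (colonI U b)))%N.
Proof.
move=> cU cL.
have [n [maxn ->]] := lam_split cU (@mem_addIr _ (b *: L)%I U).
have sL : {subset capI L (colonI U b) <= L} by move=> x /andP[].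
have [p [maxp ->]] := lam_split (cofin_cap cL (cofin_colon b cU)) sL.
rewrite (is_max_unique maxp (proj1 (ideal_chain_max_mul b L U n) maxn)).
lia.
Qed.

Lemma lam_colon b U : cofin U ->
  (lam U = lam (principal b + U)%I + lam (colonI U b))%N.
Proof.
move=> cU; have := lam_mul b cU cofin1; rewrite lam_ideal1 addn0 => ->.
by congr (_ + lam _)%N; apply: ideal_eq => x; rewrite ?mem_capI // => /andP[].
Qed.

End LocalLength.

(** * Koszul relations and lengths in a two-dimensional Cohen-Macaulay ring *)

Section DimensionTwo.
Variables (R : comNzRingType) (m : ideal R).
Hypotheses (noethR : noetherian R) (locR : local_ring m).
Hypotheses (cmR : cohen_macaulay m) (dimR : krull_dim R 2).
Implicit Types (A B C D K L U V P : ideal R) (a b c x y z : R).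
Local Notation cofin := (cofin m).

Lemma cm_regular_pair : exists x y, [/\ x \in m, y \in m,
  nonzerodivisor_mod (zeroI R) x & nonzerodivisor_mod (principal x) y].
Proof.
have [d dimd [[s [size_s sm reg]] _]] := cmR.
move: size_s; rewrite (is_max_unique dimd dimR); case: s sm reg => [|x [|y []]] //.
move=> sm [_ reg] _; exists x, y; split; try by apply: sm; rewrite !inE eqxx ?orbT.
  move=> z /=; rewrite mem_zeroI => /eqP xz0.
  have /generated_span // : Defs.generated [::] z.
  by apply: (reg 0%N) => //=; apply/generated_span; rewrite xz0 ideal_mem0.
move=> z yz.
have /generated_span/addIP[t [w [tx]]] : Defs.generated [:: x] z.
  by apply: (reg 1%N) => //=; apply/generated_span/mem_addIl.
by rewrite mem_zeroI => /eqP -> ->; rewrite addr0.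
Qed.

(** Otherwise P lies strictly below m, and applying [prime_below] to y and then to x gives primes P0
    < P1 < P < m, one step too many for dimension two. *)
Lemma regular_pair_prime x y P : x \in m -> y \in m ->
  nonzerodivisor_mod (zeroI R) x -> nonzerodivisor_mod (principal x) y ->
  prime_ideal P -> x \in P -> y \in P -> {subset m <= P}.
Proof.
move=> xm ym xreg yreg pP xP yP; apply: contrapT => nmP.
have [P1 [pP1 sP1 sP1P yP1]] := prime_below yreg pP (principal_sub xP).
have s0 : {subset zeroI R <= P1} by apply: principal_sub; exact: ideal_mem0.
have [P0 [pP0 _ sP01 xP0]] := prime_below xreg pP1 s0.
have prime_m : prime_ideal m.
  split=> [|u v uvm]; first exact: local_1 locR.
  by case: (boolP (u \in m)) => // um; apply: local_prime locR _ _ uvm um.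
have sPm : {subset P <= m} by apply: proper_sub_local locR _ (proj1 pP).
have [_ /(_ 3%N)] := dimR; suff chain : exists P : nat -> ideal R,
    (forall i, (i <= 3)%N -> prime_ideal (P i)) /\
    (forall i, (i < 3)%N -> Defs.proper_sub (P i) (P i.+1)) by move/(_ chain).
exists (fun i => nth m [:: P0; P1; P] i); split=> [[|[|[|[|i]]]]|[|[|[|i]]]] //= _.
- split=> // /(_ x (sP1 _ (principal_id x))) => xin.
  by rewrite xin in xP0.
- by split=> // /(_ _ yP) yin; rewrite yin in yP1.
Qed.

(** If no power of some t in m were in (x, y), a prime over (x, y) avoiding all powers of t would
    nevertheless contain m. *)
Lemma regular_pair_cofin x y : x \in m -> y \in m ->
  nonzerodivisor_mod (zeroI R) x -> nonzerodivisor_mod (principal x) y ->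
  cofin (pairI x y).
Proof.
move=> xm ym xreg yreg; apply: cofin_pow => // t tm; apply: contrapT => npow.
pose S z := exists n, z = t ^+ n.
have SM z w : S z -> S w -> S (z * w).
  by move=> [p ->] [q ->]; exists (p + q)%N; rewrite exprD.
have avS : avoids S (pairI x y).
  by move=> z zxy [p zE]; apply: npow; exists p; rewrite -zE.
have [|P [sP avP pP]] := prime_avoiding _ SM avS; first by exists 0%N.
apply: (avP t); last by exists 1%N.
by apply: (regular_pair_prime xm ym xreg yreg pP _ _ tm); apply: sP; rewrite ?pairI_l ?pairI_r.
Qed.

Definition koszul_exact a b :=
  forall u v, a * u + b * v = 0 -> exists w, u = b * w /\ v = - (a * w).

(* The ideal (a, b) annihilates its first Koszul homology, and a regular
   sequence X, Y inside (a, b) leaves no room for such a nonzero class. *)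
Lemma cofin_koszul a b : cofin (pairI a b) -> koszul_exact a b.
Proof.
move=> [n sab]; have [x [y [xm ym xreg yreg]]] := cm_regular_pair.
have Xreg z : x ^+ n * z = 0 -> z = 0.
  move=> xz0; have := nonzerodivisor_modX xreg (n := n) (z := z).
  by rewrite xz0 !mem_zeroI eqxx => /(_ isT)/eqP.
have yregX : nonzerodivisor_mod (principal (x ^+ n)) y.
  elim: (n) => [|k IHk] z /mem_principal[t Dt].
    by apply/mem_principal; exists z; rewrite mul1r.
  have /yreg/mem_principal[w Dw] : y * z \in principal x.
    by apply/mem_principal; exists (x ^+ k * t); rewrite Dt exprS mulrA.
  have /IHk/mem_principal[w' Dw'] : y * w \in principal (x ^+ k).
    apply/mem_principal; exists t; apply/eqP; rewrite -subr_eq0 -mem_zeroI.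
    apply: xreg; rewrite mem_zeroI mulrBr subr_eq0 (mulrA x (x ^+ k)).
    by rewrite -exprS -Dt Dw mulrCA.
  by apply/mem_principal; exists w'; rewrite Dw Dw' exprS mulrA.
have Yreg := nonzerodivisor_modX yregX (n := n).
have [al [be DX]] := pairIP _ _ _ (sab _ (mem_expI n xm)).
have [ga [de DY]] := pairIP _ _ _ (sab _ (mem_expI n ym)).
move=> u v uv0; have av : b * v = - (a * u) by apply/eqP; rewrite -addr_eq0 addrC uv0.
set X := x ^+ n in DX Xreg Yreg *; set Y := y ^+ n in DY Yreg *.
(* X and Y lie in (a, b), so X(u, v) and Y(u, v) are trivial Koszul relations; [w] and [w'] are
   their witnesses, read off from the coefficients of X and Y. *)
pose w := be * u - al * v; pose w' := de * u - ga * v.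
have Xu : X * u = b * w by rewrite DX /w; ring: av.
have Xv : X * v = - (a * w) by rewrite DX /w; ring: av.
have Yu : Y * u = b * w' by rewrite DY /w'; ring: av.
have Yv : Y * v = - (a * w') by rewrite DY /w'; ring: av.
(* X w' - Y w is killed by a and b, hence by X, hence is zero. Regularity of Y modulo X then makes w
   a multiple X w1, and cancelling X leaves w1 as the witness for (u, v). *)
have bww : b * (X * w' - Y * w) = 0.
  by rewrite mulrBr !(mulrCA b) -Xu -Yu mulrCA subrr.
have aww : a * (X * w' - Y * w) = 0.
  rewrite mulrBr !(mulrCA a) -(opprK (a * w)) -(opprK (a * w')) -Xv -Yv.
  by rewrite !mulrN opprK mulrCA addNr.
have : X * (X * w' - Y * w) = 0.
  by rewrite {1}DX mulrDl !(mulrAC _ _ (X * w' - Y * w)) aww bww !mul0r addr0.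
move/Xreg/eqP; rewrite subr_eq0 => /eqP Dw.
have /Yreg/mem_principal[w1 Dw1] : Y * w \in principal X by apply/mem_principal; exists w'.
exists w1; split; apply/eqP; rewrite -subr_eq0; apply/eqP/Xreg; rewrite mulrBr.
  by rewrite Xu Dw1 mulrCA subrr.
by rewrite Xv Dw1 mulrN opprK mulrCA addNr.
Qed.

Lemma cofin_pairX a b p q : cofin (pairI a b) -> cofin (pairI (a ^+ p) (b ^+ q)).
Proof.
move=> cab; apply: cofinS (cofinX (p + q) cab) _ => x /expI_add_sub.
by rewrite !principal_exp.
Qed.

(** Split along multiplication by a: the Koszul relations of (a, b) give (ac, b) : a = (c, b). *)
Lemma lam_pair_mul a b c : cofin (pairI (a * c) b) ->
  lam (pairI (a * c) b) = (lam (pairI a b) + lam (pairI c b))%N.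
Proof.
move=> cacb.
have sab : {subset pairI (a * c) b <= pairI a b}.
  by apply: pairI_sub; [apply: ideal_memMr (pairI_l _ _)|apply: pairI_r].
have exab := cofin_koszul (cofinS cacb sab).
rewrite (lam_colon noethR locR a cacb); congr (_ + _)%N; congr lam; apply: ideal_eq.
- by apply: addI_sub => //; apply: principal_sub; apply: pairI_l.
- apply: pairI_sub; first exact/mem_addIl/principal_id.
  exact/mem_addIr/pairI_r.
- move=> z; rewrite mem_colonI => /pairIP[t [s azE]].
  have [|w [Dz _]] := exab (z - c * t) (- s).
    by rewrite mulrBr azE mulrN mulrA; ring.
  by rewrite -(subrK (c * t) z) Dz addrC; apply/pairIP; exists t, w.
- apply: pairI_sub; rewrite mem_colonI; first exact: pairI_l.
  by apply: ideal_memM; apply: pairI_r.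
Qed.

Lemma lam_pairX a b p q : cofin (pairI a b) ->
  lam (pairI (a ^+ p) (b ^+ q)) = (p * q * lam (pairI a b))%N.
Proof.
have lamXl c d n : cofin (pairI c d) -> lam (pairI (c ^+ n) d) = (n * lam (pairI c d))%N.
  move=> ccd; elim: n => [|n IHn].
    rewrite (_ : pairI _ _ = ideal1 R) ?(lam_ideal1 noethR locR) //.
    by apply: ideal_eq => // x _; rewrite -(mulr1 x) ideal_memM ?pairI_l.
  have ccdX : cofin (pairI (c * c ^+ n) d).
    by rewrite -exprS -(expr1 d); apply: cofin_pairX.
  by rewrite exprS lam_pair_mul // IHn mulSn.
move=> cab; rewrite lamXl; last by rewrite -(expr1 a); apply: cofin_pairX.
by rewrite pairIC lamXl ?mulnA 1?pairIC.
Qed.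

(* Additivity of length along the Koszul-type complex
   R/((U:b) cap (V:a)) -> R/U + R/V -> R/(aU + bV) -> R/(a, b). *)
Lemma lam_koszul a b U V : cofin (pairI a b) -> cofin U -> cofin V ->
  (lam (a *: U + b *: V)%I + lam (capI (colonI V a) (colonI U b)) =
   lam (pairI a b) + lam U + lam V)%N.
Proof.
move=> cab cU cV; have exab := cofin_koszul cab.
have cW : cofin (a *: U + b *: V)%I.
  apply: cofinS (cofinM cab (cofinM cU cV)) _; rewrite /pairI mulIDl.
  apply: addI_sub => x; rewrite /principal -scaleIM mul1I => h.
    by apply/mem_addIl; apply: scaleIS h; apply: mulI_subl.
  by apply/mem_addIr; apply: scaleIS h; apply: mulI_subr.
(* T interpolates between aU + bV and (a, b), with T : b = (a) + V and (aU + bV) : a = b(V : a) + U.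
   The remaining two lengths come from V : a and from multiplication by b on V : a. *)
pose T := (principal a + b *: V)%I.
have cT : cofin T.
  apply: cofinS cW _; apply: addIS => //; exact: scaleIS.
have e1 : lam T = (lam (pairI a b) + lam (principal a + V)%I)%N.
  rewrite (lam_colon noethR locR b cT); congr (_ + _)%N; congr lam; apply: ideal_eq.
  - apply: addI_sub; first by apply: principal_sub; apply: pairI_r.
    apply: addI_sub; first by apply: principal_sub; apply: pairI_l.
    by move=> x xV; apply: mem_addIr; apply: scaleIS xV.
  - apply: pairI_sub; last exact/mem_addIl/principal_id.
    exact/mem_addIr/mem_addIl/principal_id.
  - move=> z; rewrite mem_colonI => /addIP[_ [_ [/mem_principal[t ->] /scaleIP[v vV ->] E]]].
    have [|w [_ Dz]] := exab (- t) (z - v); first by rewrite mulrBr E; ring.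
    rewrite -(subrK v z) Dz mem_addI //; apply/mem_principal; exists (- w).
    by rewrite mulrN.
  - apply: addI_sub => z; rewrite mem_colonI.
      by move=> /mem_principal[t ->]; apply/mem_addIl/mem_principal; exists (b * t); rewrite mulrCA.
    by move=> zV; apply/mem_addIr/mem_scaleI.
have e2 : lam (a *: U + b *: V)%I = (lam T + lam (b *: colonI V a + U)%I)%N.
  rewrite (lam_colon noethR locR a cW); congr (_ + _)%N; congr lam; apply: ideal_eq.
  - apply: addI_sub; first by apply: mem_addIl.
    by apply: addIS => //; apply: scaleIS.
  - by apply: addIS => //; apply: mem_addIr.
  - move=> z; rewrite mem_colonI => /addIP[_ [_ [/scaleIP[u uU ->] /scaleIP[v vV ->] E]]].
    have [|w [Dz Dv]] := exab (z - u) (- v); first by rewrite mulrBr E; ring.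
    rewrite -(subrK u z) Dz mem_addI ?mem_scaleI // mem_colonI.
    by rewrite -(opprK (a * w)) -Dv opprK.
  - apply: addI_sub => z; rewrite mem_colonI; last by move=> zU; apply/mem_addIl/mem_scaleI.
    move=> /scaleIP[w wV ->]; rewrite mulrCA; exact/mem_addIr/mem_scaleI.
have e3 := lam_colon noethR locR a cV.
have e4 := lam_mul noethR locR b cU (cofin_colon a cV).
lia.
Qed.

End DimensionTwo.

(** * Existence of joint reductions *)

Section LineArgument.
Variables (R : comNzRingType) (m : ideal R).
Hypotheses (noethR : noetherian R) (locR : local_ring m).
Hypothesis infR : infinite_residue_field m.
Implicit Types (A B C D K L M N U V P : ideal R) (a b c x y z t : R).

Lemma spanI_sub (s : seq R) A : (forall x, x \in s -> x \in A) -> {subset spanI s <= A}.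
Proof.
elim: s => [_ x|y s IHs sA]; first by rewrite mem_zeroI => /eqP ->; rewrite ideal_mem0.
apply: addI_sub; first by apply: principal_sub; apply: sA; rewrite mem_head.
by apply: IHs => x xs; apply: sA; rewrite inE xs orbT.
Qed.

(** Generators are eliminated one at a time, inverting 1 - mu for the coefficient mu in m of the
    current one. *)
Lemma nakayama (s : seq R) L :
  {subset spanI s <= (L + m * spanI s)%I} -> {subset spanI s <= L}.
Proof.
elim: s L => [|x s IHs] L sL; first exact: spanI_sub.
have sE : spanI (x :: s) = (principal x + spanI s)%I by [].
have xL : x \in (L + m * spanI s)%I.
  have /sL/addIP[l [w [lL + xE]]] : x \in spanI (x :: s) by apply/spanI_mem/mem_head.
  rewrite sE mulIDr (mulIC m (principal x)) -scaleIM mul1I.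
  move=> /addIP[_ [v [/scaleIP[mu mum ->] vs wE]]].
  have [e eP] : exists e, (1 - mu) * e = 1.
    apply: (local_unit locR); apply/negP => m1.
    by case/negP: (local_1 locR); rewrite -(subrK mu 1) ideal_memD.
  have -> : x = e * (l + v).
    have -> : l + v = (1 - mu) * x.
      apply/eqP; rewrite eq_sym -subr_eq0.
      have -> : (1 - mu) * x - (l + v) = x - (l + (x * mu + v)) by ring.
      by rewrite -wE -xE subrr.
    by rewrite mulrA (mulrC e) eP mul1r.
  by rewrite ideal_memM ?mem_addI.
have sL' : {subset spanI s <= L}.
  apply: IHs => y ys; have : y \in spanI (x :: s) by rewrite sE; apply: mem_addIr.
  move/sL; rewrite sE mulIDr; move: y {ys}; apply: addI_sub; first exact: mem_addIl.
  apply: addI_sub; last exact: mem_addIr.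
  by apply: mulI_sub => z _ _ /mem_principal[t ->]; rewrite mulrCA ideal_memMr.
rewrite sE; apply: addI_sub => //; apply: principal_sub.
by move: xL; apply: addI_sub => // y /mulI_subr/sL'.
Qed.

(** A polynomial that is nonzero modulo m has finitely many roots in the residue field, here
    represented by [bad]. The factor theorem is applied over R after subtracting the value p(t0),
    which lies in m. *)
Lemma poly_root_classes (p : {poly R}) i : p`_i \notin m ->
  exists bad : seq R, forall t, p.[t] \in m -> exists2 t', t' \in bad & t - t' \in m.
Proof.
have [n] := ubnP (size p); elim: n p i => // n IHn p i /ltnSE le_n pi.
case: (EM (exists t, p.[t] \in m)) => [[t0 pt0]|noroot]; last first.
  by exists [::] => t pt; case: noroot; exists t.
have /factor_theorem[q Dq] : root (p - p.[t0]%:P) t0.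
  by rewrite /root !hornerE subrr.
have Dp : p = q * ('X - t0%:P) + p.[t0]%:P by rewrite -Dq subrK.
have [j qj] : exists j, q`_j \notin m.
  apply: contrapT => allq; case/negP: pi.
  have qm j : q`_j \in m by apply: contrapT => /negP qj; apply: allq; exists j.
  rewrite Dp mulrBr coefD coefB coefMX coefMC coefC.
  apply: ideal_memD; last by case: ifP => // _; apply: ideal_mem0.
  apply: ideal_memB; last exact: ideal_memMr.
  by case: ifP => // _; apply: ideal_mem0.
have q0 : q != 0 by apply: contraNneq qj => ->; rewrite coef0 ideal_mem0.
have [|bad badP] := IHn q j _ qj.
  have : (size (p - p.[t0]%:P)%R <= maxn (size p) 1)%N.
    apply: leq_trans (size_polyD _ _) _; rewrite size_polyN geq_max leq_maxl.
    by apply: leq_trans (size_polyC_leq1 _) (leq_maxr _ _).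
  rewrite Dq size_Mmonic ?monicXsubC // size_XsubC addn2 /=.
  have : (0 < size q)%N by rewrite size_poly_gt0.
  move=> q1; rewrite leq_max => /orP[lt_qp|]; first exact: leq_trans lt_qp le_n.
  by rewrite ltnS leqNgt q1.
exists (t0 :: bad) => t pt.
have qt : (t - t0) * q.[t] \in m.
  rewrite mulrC -[_ * _](_ : (p - p.[t0]%:P).[t] = _); last by rewrite Dq !hornerE.
  by rewrite !hornerE ideal_memB.
case: (boolP (t - t0 \in m)) => [tm|tm]; first by exists t0; rewrite ?mem_head.
have [t' t'bad tt'] := badP t (local_prime locR qt tm).
by exists t' => //; rewrite inE t'bad orbT.
Qed.

Lemma residue_avoid (bad : seq R) : exists t, forall t', t' \in bad -> t - t' \notin m.
Proof.
apply: contrapT => allbad; apply: infR.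
apply: sub_finite_set (finite_seq [seq \pi_({ideal_quot m})%qT t' | t' <- bad]).
move=> q _ /=; have [t' t'bad tm] : exists2 t', t' \in bad & repr q - t' \in m.
  apply: contrapT => nt'; apply: allbad; exists (repr q) => t' t'bad.
  by apply/negP => tm; apply: nt'; exists t'.
apply/mapP; exists t' => //; apply/eqP.
by rewrite -[q]reprK pi_eq.
Qed.

(** Cramer's rule: multiply by the adjugate and then by the inverse of the determinant. *)
Lemma det_solve d (C : 'M[R]_d) (u : 'I_d -> R) L : \det C \notin m ->
  (forall i, (\sum_j C i j * u j : R) \in L) -> forall i, u i \in L.
Proof.
move=> /(local_unit locR)[e detC] CuL i.
have : (\adj C *m (C *m (\col_j u j))) i ord0 \in L.
  rewrite mxE; apply: ideal_mem_sum => j; apply: ideal_memM; rewrite mxE.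
  rewrite (eq_bigr (fun k => C j k * u k)); first exact: CuL.
  by move=> k _; rewrite mxE.
rewrite mulmxA mul_adj_mx mul_scalar_mx !mxE => dL.
by rewrite -(mul1r (u i)) -detC mulrAC ideal_memMr.
Qed.

Definition spans_mod M A B N a b := {subset M <= (N + (a *: A + b *: B))%I}.

(* Surjectivity onto M/N is detected along a line by the nonvanishing of the
   polynomial det(1 + tC), so it only fails for finitely many t modulo m. *)
Lemma spans_mod_line M A B N a b c d :
  {subset (c *: A)%I <= M} -> {subset (d *: B)%I <= M} -> spans_mod M A B N a b ->
  exists bad : seq R, forall t, (forall t', t' \in bad -> t - t' \notin m) ->
    spans_mod M A B N (a + t * c) (b + t * d).
Proof.
move=> cAM dBM spM; have [s Ms] := noetherian_span noethR M.
have sM (i : 'I_(size s)) : s`_i \in M by rewrite Ms spanI_mem ?mem_nth.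
have /choice[f fP] : forall i : 'I_(size s), exists w : R * R * R,
    [/\ w.1.1 \in N, w.1.2 \in A, w.2 \in B &
      s`_i = w.1.1 + (a * w.1.2 + b * w.2)].
  move=> i.
  have /addIP[n [_ [nN /addIP[_ [_ [/scaleIP[x xA ->] /scaleIP[y yB ->] ->]]] sE]]] :=
    spM _ (sM i).
  by exists (n, x, y).
have /choice[C CP] : forall i : 'I_(size s), exists e : 'I_(size s) -> R,
    c * (f i).1.2 + d * (f i).2 = \sum_j e j * s`_j.
  move=> i; have [_ xA yB _] := fP i.
  have : c * (f i).1.2 + d * (f i).2 \in spanI s.
    by rewrite -Ms; apply: ideal_memD; [apply: cAM|apply: dBM]; apply: mem_scaleI.
  by move=> /generated_span[e ->]; exists e.
(* Row i of C expresses the change c x_i + d y_i of the i-th generator, where s_i = n_i + a x_i + b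
   y_i. Thus 1 + tC sends the generators into the moved ideal, and its determinant is 1 at t = 0. *)
pose Cm := \matrix_(i, j) C i j.
pose p : {poly R} := \det (1%:M + 'X *: map_mx polyC Cm).
have pE t : p.[t] = \det (1%:M + t *: Cm).
  rewrite -[LHS]/(horner_eval t p) -det_map_mx; congr (\det _).
  apply/matrixP => i j; rewrite !mxE /= /horner_eval hornerD hornerM hornerX hornerC.
  by case: (i == j); rewrite ?hornerC ?horner0.
have p0 : p`_0 \notin m.
  by rewrite -horner_coef0 pE scale0r addr0 det1 (local_1 locR).
have [bad badP] := poly_root_classes p0; exists bad => t tbad.
have detm : \det (1%:M + t *: Cm) \notin m.
  rewrite -pE; apply/negP => /badP[t' /tbad]; by move/negP.
pose L := (N + ((a + t * c)%R *: A + (b + t * d)%R *: B))%I.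
have sL : forall i : 'I_(size s), s`_i \in L.
  apply: (det_solve (u := fun i : 'I_(size s) => s`_i) detm) => i.
  have -> : \sum_j (1%:M + t *: Cm) i j * s`_j = s`_i + t * \sum_j C i j * s`_j.
    rewrite mulr_sumr -[s`_i](_ : \sum_j (1%:M : 'M[R]_(size s)) i j * s`_j = _).
      by rewrite -big_split; apply: eq_bigr => j _; rewrite !mxE mulrDl mulrA.
    rewrite (bigD1 i) //= mxE eqxx mul1r big1 ?addr0 // => j ji.
    by rewrite mxE eq_sym (negPf ji) mul0r.
  have [nN xA yB ->] := fP i; rewrite -CP.
  have -> : forall n x y : R, n + (a * x + b * y) + t * (c * x + d * y) =
    n + ((a + t * c) * x + (b + t * d) * y) by move=> n x y; ring.
  by rewrite /L !mem_addI ?mem_scaleI.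
by rewrite /spans_mod Ms; apply: spanI_sub => x /(nthP 0)[i lt_i <-]; apply: (sL (Ordinal lt_i)).
Qed.

(** Join a pair good for the first n moduli to one good for the next. Each modulus excludes finitely
    many residue classes of the line parameter, and the residue field is infinite. *)
Lemma spans_mod_common M A B I J (N : nat -> ideal R) n :
  {subset (I * A)%I <= M} -> {subset (J * B)%I <= M} ->
  (forall i, (i < n)%N -> exists a b, [/\ a \in I, b \in J & spans_mod M A B (N i) a b]) ->
  exists a b, [/\ a \in I, b \in J & forall i, (i < n)%N -> spans_mod M A B (N i) a b].
Proof.
move=> sIA sJB; have sub (a : R) D E : a \in D -> {subset (D * E)%I <= M} -> {subset (a *: E)%I <= M}.
  by move=> aD sDE x /(scaleI_mul aD)/sDE.
elim: n => [_|n IHn spN]; first by exists 0, 0; split; rewrite ?ideal_mem0.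
have [|a0 [b0 [a0I b0J sp0]]] := IHn; first by move=> i lt_in; apply/spN/ltnW.
have [a1 [b1 [a1I b1J sp1]]] := spN n (ltnSn n).
have c01 := ideal_memB a1I a0I; have d01 := ideal_memB b1J b0J.
have c10 := ideal_memB a0I a1I; have d10 := ideal_memB b0J b1J.
have [bad badP] : exists bad : seq R, forall t,
    (forall t', t' \in bad -> t - t' \notin m) -> forall i, (i < n)%N ->
    spans_mod M A B (N i) (a0 + t * (a1 - a0)) (b0 + t * (b1 - b0)).
  elim: (n) sp0 => [_|k IHk sp0]; first by exists [::].
  have [|bad1 bad1P] := IHk; first by move=> i lt_i; apply/sp0/ltnW.
  have [bad2 bad2P] := spans_mod_line (sub _ _ _ c01 sIA) (sub _ _ _ d01 sJB) (sp0 k (ltnSn k)).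
  exists (bad1 ++ bad2) => t tbad i; rewrite ltnS leq_eqVlt => /orP[/eqP ->|lt_ik].
    by apply: bad2P => t' t'2; apply: tbad; rewrite mem_cat t'2 orbT.
  by apply: bad1P lt_ik => t' t'1; apply: tbad; rewrite mem_cat t'1.
have [bad' bad'P] := spans_mod_line (sub _ _ _ c10 sIA) (sub _ _ _ d10 sJB) sp1.
(* Seen from the other end of the line the parameter is 1 - t, so a class t' excluded there is 1 -
   t' here. *)
have [t tbad] := residue_avoid (bad ++ [seq 1 - t' | t' <- bad']).
exists (a0 + t * (a1 - a0)), (b0 + t * (b1 - b0)).
split; [by rewrite ideal_memD ?ideal_memM|by rewrite ideal_memD ?ideal_memM|move=> i].
rewrite ltnS leq_eqVlt => /orP[/eqP ->|lt_in]; last first.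
  by apply: badP lt_in => t' t'1; apply: tbad; rewrite mem_cat t'1.
have -> : a0 + t * (a1 - a0) = a1 + (1 - t) * (a0 - a1) by ring.
have -> : b0 + t * (b1 - b0) = b1 + (1 - t) * (b0 - b1) by ring.
apply: bad'P => t' t'bad; apply/negP => tt'.
have /tbad/negP : 1 - t' \in bad ++ [seq 1 - t' | t' <- bad'].
  by rewrite mem_cat; apply/orP; right; apply/mapP; exists t'.
by apply; rewrite (_ : t - (1 - t') = - (1 - t - t')) ?ideal_memN //; ring.
Qed.

End LineArgument.

(** * The bigraded Eakin-Sathaye argument *)

Section JointReductionExistence.
Variables (R : comNzRingType) (m : ideal R).
Hypotheses (noethR : noetherian R) (locR : local_ring m).
Hypotheses (cmR : cohen_macaulay m) (dimR : krull_dim R 2).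
Hypothesis infR : infinite_residue_field m.
Implicit Types (A B C D K L M U V P : ideal R) (a b c x y z t : R) (r s : nat).
Local Notation cofin := (cofin m).

(** Bounds the number of generators of K linearly in j. The ideal mK contains xK + yK, whose
    colength follows from [lam_koszul]; the correction involves l(R/((x) + K)), which is at most
    l(R/(x, y^j)) = j l(R/(x, y)). *)
Lemma lam_m_mul x y K j : x \in m -> y \in m -> cofin (pairI x y) -> cofin K ->
  y ^+ j \in K -> (lam (m * K)%I <= lam K + j.+1 * lam (pairI x y))%N.
Proof.
move=> xm ym cxy cK yjK.
have cKy : cofin (x *: K + y *: K)%I.
  apply: cofinS (cofinM cxy cK) _; rewrite /pairI mulIDl /principal -!scaleIM !mul1I.
  by move=> z.
have le1 : (lam (m * K)%I <= lam (x *: K + y *: K)%I)%N.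
  by apply: (lam_le noethR locR cKy); apply: addI_sub; apply: scaleI_mul.
have eK := lam_koszul noethR locR cmR dimR cxy cK cK.
have le2 : (lam (colonI K x) <= lam (capI (colonI K x) (colonI K y)))%N.
  apply: (lam_le noethR locR); first by apply: cofin_cap; apply: cofin_colon.
  by move=> z /andP[].
have eKx := lam_colon noethR locR x cK.
have le3 : (lam (principal x + K)%I <= j * lam (pairI x y))%N.
  rewrite -[j]mul1n -(lam_pairX noethR locR cmR dimR _ _ cxy) expr1.
  apply: (lam_le noethR locR); first by rewrite -[x]expr1; apply: cofin_pairX.
  by apply: addIS => //; apply: principal_sub.
lia.
Qed.

Section Bigraded.
Variables I J : ideal R.
Hypotheses (cI : cofin I) (cJ : cofin J).
Local Notation W r s := (I ^+ r * J ^+ s)%I.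

Lemma cofinW r s : cofin (W r s).
Proof. by apply: cofinM; apply: cofinX. Qed.

(* [Wl r s] and [Wd r s] stand for I^(r-1)J^s and I^rJ^(s-1), read as the zero
   ideal when the exponent is negative. *)
Definition Wl r s := if r is r'.+1 then W r' s else zeroI R.
Definition Wd r s := if s is s'.+1 then W r s' else zeroI R.

Lemma mul_zeroI A : (A * zeroI R = zeroI R)%I.
Proof. by apply: ideal_eq; [apply: mulI_subr|apply: principal_sub; apply: ideal_mem0]. Qed.

Lemma mulIW r s : (I * W r s = W r.+1 s)%I. Proof. by rewrite mulIA -expIS. Qed.
Lemma mulJW r s : (J * W r s = W r s.+1)%I. Proof. by rewrite mulICA -expIS. Qed.

Lemma zeroI_sub A : {subset zeroI R <= A}.
Proof. by apply: principal_sub; apply: ideal_mem0. Qed.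

Lemma mulIWl r s : {subset (I * Wl r s)%I <= W r s}.
Proof. by case: r => [|r]; rewrite /Wl ?mul_zeroI ?mulIW //; apply: zeroI_sub. Qed.
Lemma mulJWd r s : {subset (J * Wd r s)%I <= W r s}.
Proof. by case: s => [|s]; rewrite /Wd ?mul_zeroI ?mulJW //; apply: zeroI_sub. Qed.
Lemma mulJWl r s : {subset (J * Wl r s)%I <= Wl r s.+1}.
Proof. by case: r => [|r]; rewrite /Wl ?mul_zeroI ?mulJW. Qed.

Lemma mulIWd r s : {subset (I * Wd r s)%I <= Wd r.+1 s}.
Proof. by case: s => [|s]; rewrite /Wd ?mul_zeroI ?mulIW. Qed.

(* Cofinite bigraded ideals of the bigraded Rees algebra of I and J. *)
Definition bigraded_ideal (N : nat -> nat -> ideal R) := forall r s,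
  [/\ cofin (N r s), {subset N r s <= W r s},
      {subset (I * N r s)%I <= N r.+1 s} & {subset (J * N r s)%I <= N r s.+1}].

(** The degree (r, s) part of N : y for y placed in degree (0, 1); [colon_right] is the analogue for
    degree (1, 0). *)
Definition colon_up N y r s : ideal R := capI (W r s) (colonI (N r s.+1) y).
Definition colon_right N x r s : ideal R := capI (W r s) (colonI (N r.+1 s) x).

Lemma colon_mulI A L K L' K' a : {subset (A * L)%I <= L'} -> {subset (A * K)%I <= K'} ->
  {subset (A * capI L (colonI K a))%I <= capI L' (colonI K' a)}.
Proof.
move=> sL sK; apply: mulI_sub => x z xA; rewrite !mem_capI !mem_colonI => /andP[zL azK].
by rewrite sL ?mem_mulI // mulrCA sK ?mem_mulI.
Qed.

Lemma bigraded_colon_up N y : bigraded_ideal N -> bigraded_ideal (colon_up N y).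
Proof.
move=> bN r s; have [cN _ IN JN] := bN r s.+1; split.
- by apply: cofin_cap; [apply: cofinW|apply: cofin_colon].
- by move=> z /andP[].
- by apply: colon_mulI => //; rewrite mulIW.
- by apply: colon_mulI => //; rewrite mulJW.
Qed.

Lemma bigraded_colon_right N x : bigraded_ideal N -> bigraded_ideal (colon_right N x).
Proof.
move=> bN r s; have [cN _ IN JN] := bN r.+1 s; split.
- by apply: cofin_cap; [apply: cofinW|apply: cofin_colon].
- by move=> z /andP[].
- by apply: colon_mulI => //; rewrite mulIW.
- by apply: colon_mulI => //; rewrite mulJW.
Qed.

Lemma bigraded_add_right N a : a \in I -> bigraded_ideal N ->
  bigraded_ideal (fun r s => (N r s + a *: Wl r s)%I).
Proof.
move=> aI bN r s; have [cN NW IN JN] := bN r s; split.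
- exact: cofinDl.
- by apply: addI_sub => // z /(scaleI_mul aI)/mulIWl.
- by rewrite mulIDr -scaleI_mull; apply: addIS => //; apply: scaleIS; apply: mulIWl.
- by rewrite mulIDr -scaleI_mull; apply: addIS => //; apply: scaleIS; apply: mulJWl.
Qed.

(* A bigraded version of the Eakin-Sathaye theorem, proved by passing to the
   quotients by b and by (0 : b) for b in J, and below likewise for a in I. *)
Lemma eakin_sathaye_up N r s : bigraded_ideal N ->
  (lam (N r s) < lam (W r s) + s.+1)%N ->
  exists2 b, b \in J & {subset W r s <= (N r s + b *: Wd r s)%I}.
Proof.
elim: s N => [|s IHs] N bN lt_lam.
  have [cN NW _ _] := bN r 0%N; exists 0; first exact: ideal_mem0.
  move: lt_lam; rewrite addn1 ltnS => /(lam_eq noethR locR cN NW) <-.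
  exact: mem_addIl.
have [cN NW _ _] := bN r s.+1.
apply: contrapT => noB.
(* If no b works, N + bW stays strictly inside the target. By [lam_mul] the excess length allowed
   for N : b then drops by at least one, which is what the induction hypothesis needs. *)
have big b : b \in J -> (lam (W r s.+1) < lam (N r s.+1 + b *: W r s)%I)%N.
  move=> bJ; rewrite ltnNge; apply/negP => le_lam; apply: noB; exists b => //.
  rewrite -(lam_eq noethR locR (cofinDl _ cN) _ le_lam) //.
  by apply: addI_sub => // z /(scaleI_mul bJ); rewrite mulJW.
have [ys Jys] := noetherian_span noethR J.
(* The induction hypothesis gives one b for each generator y of J. A common b then handles all
   products yz, and these generate JW(r, s) = W(r, s+1). *)
have gen i : (i < size ys)%N -> exists a b, [/\ a \in I, b \in J &
    spans_mod (W r s) (zeroI R) (Wd r s) (colon_up N ys`_i r s) a b].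
  move=> lt_i; have yJ : ys`_i \in J by rewrite Jys spanI_mem ?mem_nth.
  have [|b bJ spb] := IHs _ (bigraded_colon_up ys`_i bN).
    have := lam_mul noethR locR ys`_i cN (cofinW r s); have := big _ yJ.
    rewrite /colon_up addIC; lia.
  exists 0, b; split=> //; first exact: ideal_mem0.
  by move=> z /spb; apply: addIS => //; apply: mem_addIr.
have [||a [b [_ bJ spb]]] := spans_mod_common noethR locR infR _ _ gen.
- by rewrite mul_zeroI; apply: zeroI_sub.
- exact: mulJWd.
apply: noB; exists b => //; rewrite -mulJW; apply: mulI_sub => y z yJ zW.
suff : y \in colonI (N r s.+1 + b *: W r s)%I z by rewrite mem_colonI mulrC.
rewrite Jys in yJ; move: y yJ; apply: spanI_sub => _ /(nthP 0)[i lt_i <-].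
have yJ : ys`_i \in J by rewrite Jys spanI_mem ?mem_nth.
rewrite mem_colonI mulrC.
have /addIP[n [_ [/andP[_ ynN] /addIP[_ [_ [/scaleIP[o o0 ->] /scaleIP[w wW ->] ->]]] ->]]] :=
  spb i lt_i z zW.
move: o0; rewrite mem_zeroI => /eqP ->; rewrite mulr0 add0r mulrDr mem_addI //.
by rewrite mulrCA mem_scaleI // mulJWd ?mem_mulI.
Qed.

Lemma eakin_sathaye N r s : bigraded_ideal N ->
  (lam (N r s) < lam (W r s) + r.+1 * s.+1)%N ->
  exists a b, [/\ a \in I, b \in J &
    {subset W r s <= (N r s + (a *: Wl r s + b *: Wd r s))%I}].
Proof.
elim: r N => [|r IHr] N bN lt_lam.
  have [|b bJ spb] := eakin_sathaye_up bN (r := 0) (s := s); first by rewrite mul1n in lt_lam.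
  exists 0, b; split=> //; first exact: ideal_mem0.
  by move=> z /spb; apply: addIS => //; apply: mem_addIr.
have [cN NW _ _] := bN r.+1 s.
(* Either some a lowers the excess length below s + 1, and the one-variable lemma finishes modulo a;
   or every a leaves at least s + 1, and the colons N : x meet the bound for r since (r+2)(s+1) -
   (s+1) = (r+1)(s+1). *)
case: (EM (exists2 a : R, a \in I & (lam (N r.+1 s + a *: W r s)%I < lam (W r.+1 s) + s.+1)%N)).
  move=> [a aI lt_a].
  have [b bJ spb] := @eakin_sathaye_up _ r.+1 s (bigraded_add_right aI bN) lt_a.
  exists a, b; split=> // z /spb/addIP[_ [y [/addIP[n [x [? ? ->]]] ? ->]]].
  by rewrite -addrA !mem_addI.
move=> nosmall.
have big a : a \in I -> (lam (W r.+1 s) + s.+1 <= lam (N r.+1 s + a *: W r s)%I)%N.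
  by move=> aI; rewrite leqNgt; apply/negP => lt_a; apply: nosmall; exists a.
have [xs Ixs] := noetherian_span noethR I.
have gen i : (i < size xs)%N -> exists a b, [/\ a \in I, b \in J &
    spans_mod (W r s) (Wl r s) (Wd r s) (colon_right N xs`_i r s) a b].
  move=> lt_i; have xI : xs`_i \in I by rewrite Ixs spanI_mem ?mem_nth.
  apply: IHr (bigraded_colon_right xs`_i bN) _.
  have := lam_mul noethR locR xs`_i cN (cofinW r s); have := big _ xI.
  rewrite /colon_right addIC; lia.
have [||a [b [aI bJ spab]]] := spans_mod_common noethR locR infR _ _ gen.
- exact: mulIWl.
- exact: mulJWd.
exists a, b; split=> //; rewrite -mulIW; apply: mulI_sub => x z xI zW.
suff : x \in colonI (N r.+1 s + (a *: W r s + b *: Wd r.+1 s))%I z.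
  by rewrite mem_colonI mulrC.
rewrite Ixs in xI; move: x xI; apply: spanI_sub => _ /(nthP 0)[i lt_i <-].
have xI : xs`_i \in I by rewrite Ixs spanI_mem ?mem_nth.
rewrite mem_colonI mulrC.
have /addIP[n [_ [/andP[_ xnN] /addIP[_ [_ [/scaleIP[v vW ->] /scaleIP[w wW ->] ->]]] ->]]] :=
  spab i lt_i z zW.
rewrite !mulrDr; apply: mem_addI => //; apply: mem_addI; rewrite mulrCA mem_scaleI //.
  by rewrite mulIWl ?mem_mulI.
by rewrite mulIWd ?mem_mulI.
Qed.

Lemma bigraded_m_mul : bigraded_ideal (fun r s => (m * W r s)%I).
Proof.
move=> r s; split.
- by apply: cofinM (cofinW r s); apply: cofin_m.
- exact: mulI_subr.
- by rewrite mulICA mulIW.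
- by rewrite mulICA mulJW.
Qed.

(** For N(r, s) = mI^rJ^s the hypothesis of [eakin_sathaye] bounds the number of generators of
    I^rJ^s by a product quadratic in r = s, while that number grows linearly. Nakayama then discards
    mI^rJ^s. *)
Lemma joint_reduction_exists : exists a b, joint_reduction I J a b.
Proof.
have [x0 [y0 [x0m y0m xreg yreg]]] := cm_regular_pair cmR dimR.
have c0 := regular_pair_cofin noethR locR dimR x0m y0m xreg yreg.
have [k sk] := cofin_cap cI cJ.
(* The exponent k puts y into both I and J; one more factor keeps x and y in m even when k = 0. *)
pose x := x0 ^+ k.+1; pose y := y0 ^+ k.+1.
have xm : x \in m by rewrite /x exprS ideal_memMr.
have ym : y \in m by rewrite /y exprS ideal_memMr.
have cxy : cofin (pairI x y) by apply: cofin_pairX.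
have /andP[yI yJ] : y \in capI I J by rewrite /y exprS; apply/ideal_memM/sk/mem_expI.
(* With r = s = n + 1 and j = 2n + 2 the excess length is at most (2n + 3)n/2, which is below (n +
   2)^2. *)
pose n := (2 * lam (pairI x y))%N.
have [|a [b [aI bJ spab]]] := eakin_sathaye (r := n.+1) (s := n.+1) bigraded_m_mul.
  have yn : y ^+ (n.+1 + n.+1) \in W n.+1 n.+1 by rewrite exprD mem_mulI ?mem_expI.
  have := lam_m_mul xm ym cxy (cofinW _ _) yn; rewrite /n; nia.
exists a, b; split=> //; exists n, n => z; apply/idP/idP; last first.
  by apply: addI_sub => {}z; [move/(scaleI_mul aI); rewrite mulIW|move/(scaleI_mul bJ); rewrite mulJW].
have [s Ws] := noetherian_span noethR (W n.+1 n.+1).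
rewrite Ws; apply: (nakayama locR); rewrite -Ws => t /spab; rewrite addIC.
exact.
Qed.

End Bigraded.
End JointReductionExistence.

(** * Hilbert polynomials *)

Section JointReductionLength.
Variables (R : comNzRingType) (m : ideal R).
Hypotheses (noethR : noetherian R) (locR : local_ring m).
Hypotheses (cmR : cohen_macaulay m) (dimR : krull_dim R 2).
Implicit Types (I J K : ideal R) (a b : R).
Local Notation cofin := (cofin m).

Lemma joint_reduction_cofin I J a b : cofin I -> cofin J ->
  joint_reduction I J a b -> cofin (pairI a b).
Proof.
move=> cI cJ [_ _ [r [s eIJ]]].
apply: cofinS (cofinM (cofinX r.+1 cI) (cofinX s.+1 cJ)) _ => x; rewrite eIJ.
by move: x; apply: addIS; apply: scaleIS.
Qed.

(** Multiplication carries the defining equation to all larger exponents; one application of it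
    reduces (p+1, q+1) to (p, q+1) and (p+1, q). The spare factor K is needed for the filtrations
    I^nL. *)
Lemma joint_reduction_pow I J K a b : joint_reduction I J a b ->
  exists N, forall r s p q, (N <= r)%N -> (N <= s)%N ->
    (I ^+ (r + p) * J ^+ (s + q) * K)%I =
    (a ^+ p *: (I ^+ r * J ^+ (s + q) * K) + b ^+ q *: (I ^+ (r + p) * J ^+ s * K))%I.
Proof.
move=> [aI bJ [r0 [s0 /ideal_ext eIJ]]]; exists (maxn r0 s0).
pose W r s := (I ^+ r * J ^+ s * K)%I.
have WD r s i j : W (i + r)%N (j + s)%N = (I ^+ i * J ^+ j * K * (I ^+ r * J ^+ s))%I.
  by rewrite /W !expID mulIACA -!mulIA (mulIC K) -!mulIA.
have aW r s : {subset (a *: W r s)%I <= W r.+1 s}.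
  by move=> z /(scaleI_mul aI); rewrite /W !mulIA.
have bW r s : {subset (b *: W r s)%I <= W r s.+1}.
  by move=> z /(scaleI_mul bJ); rewrite /W !mulIA (mulIC J) -(mulIA _ J).
have apW p r s : {subset (a ^+ p *: W r s)%I <= W (r + p)%N s}.
  elim: p => [|p IHp]; first by rewrite scale1I addn0.
  by rewrite exprS -scaleIA addnS => z /(scaleIS IHp)/aW.
have bqW q r s : {subset (b ^+ q *: W r s)%I <= W r (s + q)%N}.
  elim: q => [|q IHq]; first by rewrite scale1I addn0.
  by rewrite exprS -scaleIA addnS => z /(scaleIS IHq)/bW.
have step r s : (r0 <= r)%N -> (s0 <= s)%N ->
    {subset W r.+1 s.+1 <= (a *: W r s.+1 + b *: W r.+1 s)%I}.
  move=> le_r le_s.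
  rewrite -(subnK le_r) -(subnK le_s) -!addnS !WD eIJ mulIDr -!scaleI_mull.
  by apply: addIS.
suff sub p q r s : (r0 <= r)%N -> (s0 <= s)%N ->
    {subset W (r + p)%N (s + q)%N <= (a ^+ p *: W r (s + q)%N + b ^+ q *: W (r + p)%N s)%I}.
  move=> r s p q; rewrite !geq_max => /andP[le_r _] /andP[_ le_s].
  apply: ideal_eq; first exact: sub.
  by apply: addI_sub; [apply: apW|apply: bqW].
move=> le_r le_s; elim: p q => [|p IHp] q.
  by rewrite addn0 expr0 scale1I => z; apply: mem_addIl.
elim: q => [|q IHq]; first by rewrite addn0 expr0 scale1I => z; apply: mem_addIr.
rewrite !addnS => z /(step _ _ (leq_trans le_r (leq_addr _ _)) (leq_trans le_s (leq_addr _ _))).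
move: z; apply: addI_sub => z.
  rewrite -!addnS => /(scaleIS (IHp q.+1)); rewrite scaleIDr !scaleIA -exprS mulrC -scaleIA.
  by move: z; apply: addIS => //; apply: scaleIS => z /aW; rewrite addnS.
rewrite -!addnS => /(scaleIS IHq); rewrite scaleIDr !scaleIA -exprS mulrC -scaleIA.
by move: z; apply: addIS => //; apply: scaleIS => z /bW; rewrite addnS.
Qed.

Lemma nat_min_stable (L : nat -> nat -> nat) :
  (forall p p' q q', (p <= p')%N -> (q <= q')%N -> (L p' q' <= L p q)%N) ->
  exists N D, forall p q, (N <= p)%N -> (N <= q)%N -> L p q = D.
Proof.
move=> monL.
have exP : exists n, `[<exists p q, L p q = n>].
  by exists (L 0 0)%N; apply/asboolP; exists 0%N, 0%N.
case: (ex_minnP exP) => D /asboolP[p0 [q0 <-]] minD.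
exists (maxn p0 q0), (L p0 q0) => p q; rewrite !geq_max => /andP[le_p _] /andP[_ le_q].
apply/eqP; rewrite eqn_leq monL //=; apply: minD; apply/asboolP; by exists p, q.
Qed.

(* For a joint reduction, the only obstruction to the mixed difference being
   pq lam(a, b) is the length of ((W(r, s+q) : b^q) cap (W(r+p, s) : a^p)) / W(r, s);
   this is bounded by lam W(r, s) and monotone in p and q, hence eventually constant. *)
Lemma joint_reduction_mixed I J K a b : cofin I -> cofin J -> cofin K ->
  joint_reduction I J a b ->
  exists r0 s0 N D, forall p q, (N <= p)%N -> (N <= q)%N ->
    (lam (I ^+ (r0 + p) * J ^+ (s0 + q) * K)%I + D =
     p * q * lam (pairI a b) + lam (I ^+ r0 * J ^+ (s0 + q) * K)%I +
     lam (I ^+ (r0 + p) * J ^+ s0 * K)%I)%N.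
Proof.
move=> cI cJ cK jr; have cab := joint_reduction_cofin cI cJ jr.
have [aI bJ _] := jr.
have [N0 NP] := joint_reduction_pow K jr; exists N0, N0.
pose W r s := (I ^+ r * J ^+ s * K)%I.
have cW r s : cofin (W r s) by apply: cofinM cK; apply: cofinM; apply: cofinX.
pose Co p q := capI (colonI (W (N0 + p)%N N0) (a ^+ p)) (colonI (W N0 (N0 + q)%N) (b ^+ q)).
have monCo p p' q q' : (p <= p')%N -> (q <= q')%N -> {subset Co p q <= Co p' q'}.
  move=> /subnK <- /subnK <- z; rewrite !mem_capI !mem_colonI => /andP[zp zq].
  rewrite !exprD -!mulrA; apply/andP; split.
    rewrite addnCA /W expID -!mulIA; apply: mem_mulI; first exact: mem_expI.
    by rewrite mulIA.
  rewrite addnCA /W expID -!mulIA mulICA; apply: mem_mulI; first exact: mem_expI.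
  by rewrite mulIA.
have [|N [D ND]] := @nat_min_stable (fun p q => lam (Co p q)).
  move=> p p' q q' le_p le_q; apply: (lam_le noethR locR) (monCo _ _ _ _ le_p le_q).
  by apply: cofin_cap; apply: cofin_colon.
exists N, D => p q le_p le_q; rewrite -(ND p q) // (NP _ _ p q) //.
rewrite (lam_koszul noethR locR cmR dimR (cofin_pairX p q cab) (cW _ _) (cW _ _)).
by rewrite (lam_pairX noethR locR cmR dimR _ _ cab).
Qed.

End JointReductionLength.

Lemma bin2S n : 'C(n.+2, 2)%:Z = 'C(n.+1, 2)%:Z + n%:Z + 1.
Proof. by rewrite binS bin1 PoszD -addn1 PoszD addrA. Qed.

Lemma second_difference_poly (f : nat -> int) (e : int) N :
  (forall n, (N <= n)%N -> f n.+2 + f n = f n.+1 + f n.+1 + e) ->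
  exists e1 e2, forall n, (N <= n)%N -> f n = e * 'C(n.+1, 2)%:Z - e1 * n%:Z + e2.
Proof.
(* [e1] fits the first difference at N, and the constant term fits f at N. *)
move=> fP; pose e1 := e * (N%:Z + 1) - (f N.+1 - f N).
exists e1, (f N - e * 'C(N.+1, 2)%:Z + e1 * N%:Z) => n le_n.
rewrite -(subnK le_n); move: (n - N)%N => k {n le_n}.
suff [] : f (k + N)%N = e * 'C((k + N).+1, 2)%:Z - e1 * (k + N)%:Z +
      (f N - e * 'C(N.+1, 2)%:Z + e1 * N%:Z) /\
    f (k + N).+1 - f (k + N)%N = e * ((k + N)%:Z + 1) - e1 by [].
elim: k => [|k [IH1 IH2]]; first by rewrite add0n /e1; split; ring.
have := fP (k + N)%N (leq_addl _ _); move: IH1 IH2; rewrite addSn bin2S.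
move: (f _) (f _) (f _) (f N) => f2 f1 f0 fN; move: e1 ('C(_, 2)) ('C(_, 2)) => e1 c1 c2.
rewrite -addn1 !PoszD => IH1 IH2 IH3; split; lia.
Qed.

Lemma bigraded_difference_poly (H : nat -> nat -> int) (e11 e20 e02 : int) :
  (exists r0 s0 N D, forall p q, (N <= p)%N -> (N <= q)%N ->
    H (r0 + p)%N (s0 + q)%N + D = p%:Z * q%:Z * e11 + H r0 (s0 + q)%N + H (r0 + p)%N s0) ->
  (forall s, exists N, forall n, (N <= n)%N ->
    H n.+2 s + H n s = H n.+1 s + H n.+1 s + e20) ->
  (forall r, exists N, forall n, (N <= n)%N ->
    H r n.+2 + H r n = H r n.+1 + H r n.+1 + e02) ->
  exists e10 e01 e00 N, forall r s, (N <= r)%N -> (N <= s)%N ->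
    H r s = e20 * 'C(r.+1, 2)%:Z + e11 * r%:Z * s%:Z + e02 * 'C(s.+1, 2)%:Z -
      e10 * r%:Z - e01 * s%:Z + e00.
Proof.
move=> [r0 [s0 [N [D HP]]]] rP sP.
have [N1 /second_difference_poly[al [be rH]]] := rP (s0 + N)%N.
have [N2 /second_difference_poly[ga [de sH]]] := sP (r0 + N)%N.
exists (al + e11 * (s0 + N)%:Z), (ga + e11 * (r0 + N)%:Z),
  (be + de - H (r0 + N)%N (s0 + N)%N + e11 * (r0 + N)%:Z * (s0 + N)%:Z),
  (N1 + N2 + r0 + s0 + N)%N => r s le_r le_s.
have [p [le_p Dr]] : exists p, (N <= p)%N /\ r = (r0 + p)%N by exists (r - r0)%N; lia.
have [q [le_q Ds]] : exists q, (N <= q)%N /\ s = (s0 + q)%N by exists (s - s0)%N; lia.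
have {}rH := rH r; have {}sH := sH s.
have h1 := HP p q le_p le_q; have h2 := HP p N le_p (leqnn N).
have h3 := HP N q (leqnn N) le_q; have h4 := HP N N (leqnn N) (leqnn N).
have {}rH : H r (s0 + N)%N = e20 * 'C(r.+1, 2)%:Z - al * r%:Z + be by apply: rH; lia.
have {}sH : H (r0 + N)%N s = e02 * 'C(s.+1, 2)%:Z - ga * s%:Z + de by apply: sH; lia.
(* The instances (p, q), (p, N), (N, q), (N, N) together eliminate D and the values on the lines r0
   and s0, leaving one row and one column whose polynomials are known. *)
have -> : H r s = H r (s0 + N)%N + H (r0 + N)%N s - H (r0 + N)%N (s0 + N)%N +
    e11 * (r%:Z - (r0 + N)%:Z) * (s%:Z - (s0 + N)%:Z).
  rewrite Dr Ds; move: (H _ _) (H _ _) (H _ _) (H _ _) (H _ _) (H _ _) (H _ _) (H _ _) h1 h2 h3 h4.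
  move=> *; rewrite !PoszD; lia.
rewrite rH sH; ring.
Qed.

Section HilbertPolynomials.
Variables (R : comNzRingType) (m : ideal R).
Hypotheses (noethR : noetherian R) (locR : local_ring m).
Hypotheses (cmR : cohen_macaulay m) (dimR : krull_dim R 2).
Hypothesis infR : infinite_residue_field m.
Implicit Types (I J K L : ideal R) (a b : R).
Local Notation cofin := (cofin m).

(** For a joint reduction of I with itself only the sum of the two exponents counts, so the mixed
    difference over a unit square becomes a second difference over three consecutive powers. *)
Lemma lam_second_difference I L a b : cofin I -> cofin L ->
  joint_reduction I I a b ->
  exists N, forall n, (N <= n)%N ->
    (lam (I ^+ n.+2 * L)%I + lam (I ^+ n * L)%I =
     lam (I ^+ n.+1 * L)%I + lam (I ^+ n.+1 * L)%I + lam (pairI a b))%N.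
Proof.
move=> cI cL jr.
have [r0 [s0 [N [D mixed]]]] := joint_reduction_mixed noethR locR cmR dimR cI cI cL jr.
exists (r0 + s0 + N + N)%N => n le_n.
have [p [le_p ->]] : exists p, (N <= p)%N /\ n = (r0 + p + (s0 + N))%N.
  by exists (n - r0 - s0 - N)%N; lia.
have h1 := mixed p.+1 N.+1 (leqW le_p) (leqW (leqnn N)).
have h2 := mixed p N.+1 le_p (leqW (leqnn N)).
have h3 := mixed p.+1 N (leqW le_p) (leqnn N).
have h4 := mixed p N le_p (leqnn N).
move: h1 h2 h3 h4; rewrite -!expID !addnS !addSn.
lia.
Qed.

(** The second difference of l(R/I^nL) does not depend on L. Taking L = R and L = J^s shows that the
    bigraded polynomial has the same leading coefficient in r as the polynomial of I; likewise for
    J. *)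
Lemma hilbert_polynomials I J a b : cofin I -> cofin J -> joint_reduction I J a b ->
  exists (e0I e1I e2I e0J e1J e2J e10 e01 e00 : int) N,
  [/\ forall n, (N <= n)%N ->
        (lam (I ^+ n)%I)%:Z = e0I * 'C(n.+1, 2)%:Z - e1I * n%:Z + e2I,
      forall n, (N <= n)%N ->
        (lam (J ^+ n)%I)%:Z = e0J * 'C(n.+1, 2)%:Z - e1J * n%:Z + e2J &
      forall r s, (N <= r)%N -> (N <= s)%N ->
        (lam (I ^+ r * J ^+ s)%I)%:Z =
          e0I * 'C(r.+1, 2)%:Z + (lam (pairI a b))%:Z * r%:Z * s%:Z + e0J * 'C(s.+1, 2)%:Z -
          e10 * r%:Z - e01 * s%:Z + e00].
Proof.
move=> cI cJ jr.
have [aI [bI jrI]] := joint_reduction_exists noethR locR cmR dimR infR cI cI.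
have [aJ [bJ jrJ]] := joint_reduction_exists noethR locR cmR dimR infR cJ cJ.
have dI L (cL : cofin L) := lam_second_difference cI cL jrI.
have dJ L (cL : cofin L) := lam_second_difference cJ cL jrJ.
have [N1 dI1] := dI _ (cofin1 m); have [N2 dJ1] := dJ _ (cofin1 m).
have [|e1I [e2I PI]] := @second_difference_poly (fun n => (lam (I ^+ n)%I)%:Z) (lam (pairI aI bI)) N1.
  by move=> n /dI1; rewrite !mulI1; lia.
have [|e1J [e2J PJ]] := @second_difference_poly (fun n => (lam (J ^+ n)%I)%:Z) (lam (pairI aJ bJ)) N2.
  by move=> n /dJ1; rewrite !mulI1; lia.
have [||| e10 [e01 [e00 [N3 PH]]]] := @bigraded_difference_poly
  (fun r s => (lam (I ^+ r * J ^+ s)%I)%:Z) (lam (pairI a b)) (lam (pairI aI bI)) (lam (pairI aJ bJ)).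
- have [r0 [s0 [N [D mixed]]]] := joint_reduction_mixed noethR locR cmR dimR cI cJ (cofin1 m) jr.
  exists r0, s0, N, D%:Z => p q /mixed h /h; rewrite !mulI1; lia.
- move=> s; have [N NP] := dI _ (cofinX s cJ); exists N => n /NP; lia.
- move=> r; have [N NP] := dJ _ (cofinX r cI); exists N => n /NP; rewrite !(mulIC (I ^+ r)%I); lia.
exists (lam (pairI aI bI)), e1I, e2I, (lam (pairI aJ bJ)), e1J, e2J, e10, e01, e00, (N1 + N2 + N3)%N.
split=> [n le_n|n le_n|r s le_r le_s]; [apply: PI|apply: PJ|apply: PH]; lia.
Qed.

End HilbertPolynomials.

Lemma PoszS n : n.+1%:Z = n%:Z + 1. Proof. by rewrite -addn1 PoszD. Qed.

(** * Uniqueness of the Hilbert coefficients *)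

Section Coefficients.
Variable R : comNzRingType.
Implicit Types (A B I J K : ideal R).

Lemma hilbert_coefs_unique K e e' i : hilbert_coefs K e -> hilbert_coefs K e' ->
  (i <= 2)%N -> e i = e' i.
Proof.
move=> [N eP] [N' eP'] le_i2.
have same n : (maxn N N' <= n)%N -> e 0%N * 'C(n.+1, 2)%:Z - e 1%N * n%:Z + e 2%N =
    e' 0%N * 'C(n.+1, 2)%:Z - e' 1%N * n%:Z + e' 2%N.
  rewrite geq_max => /andP[/eP[l len <-] /eP'[l' len' <-]].
  by rewrite (is_max_unique len len').
move: same; set M := maxn N N' => same.
have h1 := same M (leqnn M); have h2 := same M.+1 (leqW (leqnn M)).
have h3 := same M.+2 (leqW (leqW (leqnn M))).
move: h1 h2 h3; rewrite !bin2S !PoszS.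
move: ('C(_, 2)) le_i2 => c; case: i => [|[|[|]]] //= _;
  move: (e 0%N) (e 1%N) (e 2%N) (e' 0%N) (e' 1%N) (e' 2%N) => a0 a1 a2 b0 b1 b2 h1 h2 h3.
- lia.
- have e0 : a0 = b0 by lia.
  by rewrite e0 in h1 h2; lia.
have e0 : a0 = b0 by lia.
rewrite e0 in h1 h2 h3; have e1 : a1 = b1 by lia.
by rewrite e1 in h1; lia.
Qed.

Lemma hilbert_coefE K e i : hilbert_coefs K e -> (i <= 2)%N -> hilbert_coef K i = e i.
Proof.
move=> eP le_i2; apply: xget_unique; first by exists e.
by move=> _ [e' eP' ->]; apply: hilbert_coefs_unique eP' eP le_i2.
Qed.

Lemma bigraded_hilbert_sum (e : nat -> nat -> int) r s :
  \sum_(i < 3) \sum_(j < 3 | (i + j <= 2)%N)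
     (-1) ^+ (i + j) * e i j * 'C(r + i - 1, i)%:Z * 'C(s + j - 1, j)%:Z =
  e 0%N 0%N - e 1%N 0%N * r%:Z - e 0%N 1%N * s%:Z + e 1%N 1%N * r%:Z * s%:Z +
  e 2%N 0%N * 'C(r.+1, 2)%:Z + e 0%N 2%N * 'C(s.+1, 2)%:Z.
Proof.
rewrite !big_ord_recl !big_ord0.
do 3![rewrite big_mkcond /= !big_ord_recl !big_ord0 /=].
rewrite /bump /= !addn0 !bin0 !addn1 !addn2 !subn1 /= !bin1.
ring.
Qed.

Lemma bigraded_hilbert_coefs_unique I J e e' :
  bigraded_hilbert_coefs I J e -> bigraded_hilbert_coefs I J e' ->
  e 1%N 0%N = e' 1%N 0%N /\ e 0%N 1%N = e' 0%N 1%N.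
Proof.
move=> [N eP] [N' eP'].
have same r s : (maxn N N' <= r)%N -> (maxn N N' <= s)%N ->
    e 0%N 0%N - e 1%N 0%N * r%:Z - e 0%N 1%N * s%:Z + e 1%N 1%N * r%:Z * s%:Z +
      e 2%N 0%N * 'C(r.+1, 2)%:Z + e 0%N 2%N * 'C(s.+1, 2)%:Z =
    e' 0%N 0%N - e' 1%N 0%N * r%:Z - e' 0%N 1%N * s%:Z + e' 1%N 1%N * r%:Z * s%:Z +
      e' 2%N 0%N * 'C(r.+1, 2)%:Z + e' 0%N 2%N * 'C(s.+1, 2)%:Z.
  rewrite !geq_max -!bigraded_hilbert_sum => /andP[rN rN'] /andP[sN sN'].
  have [l len <-] := eP r s rN sN; have [l' len' <-] := eP' r s rN' sN'.
  by rewrite (is_max_unique len len').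
move: same; set M := maxn N N' => same.
have M1 := leqW (leqnn M); have M2 := leqW M1.
have h00 := same M M (leqnn M) (leqnn M); have h10 := same M.+1 M M1 (leqnn M).
have h01 := same M M.+1 (leqnn M) M1; have h11 := same M.+1 M.+1 M1 M1.
have h20 := same M.+2 M M2 (leqnn M); have h02 := same M M.+2 (leqnn M) M2.
move: h00 h10 h01 h11 h20 h02; rewrite !bin2S !PoszS.
move: ('C(_, 2)) => c.
move: (e 0%N 0%N) (e 1%N 0%N) (e 0%N 1%N) (e 1%N 1%N) (e 2%N 0%N) (e 0%N 2%N).
move: (e' 0%N 0%N) (e' 1%N 0%N) (e' 0%N 1%N) (e' 1%N 1%N) (e' 2%N 0%N) (e' 0%N 2%N).
move=> a00 a10 a01 a11 a20 a02 b00 b10 b01 b11 b20 b02 h00 h10 h01 h11 h20 h02.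
have e11 : a11 = b11 by lia.
have e20 : a20 = b20 by rewrite e11 in h00 h10 h20; lia.
have e02 : a02 = b02 by rewrite e11 in h00 h01 h02; lia.
by rewrite e11 e20 e02 in h00 h10 h01; split; lia.
Qed.

Lemma bigraded_hilbert_coefE I J e : bigraded_hilbert_coefs I J e ->
  bigraded_hilbert_coef I J 1 0 = e 1%N 0%N /\ bigraded_hilbert_coef I J 0 1 = e 0%N 1%N.
Proof.
move=> eP; split; apply: xget_unique; try by exists e.
  by move=> _ [e' /(bigraded_hilbert_coefs_unique eP)[-> _] ->].
by move=> _ [e' /(bigraded_hilbert_coefs_unique eP)[_ ->] ->].
Qed.

Lemma zero_subquotP A B : zero_module (subquot A B) <-> {subset A <= B}.
Proof.
pose pr (y : submod A) := (\pi_{ideal_quot (sub_in_mod A B)} y)%qT.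
have pr0 y : (pr y == 0) = (\val y \in B).
  have -> : (pr y == 0) = (pr y == pr 0) by congr (_ == _); rewrite /pr raddf0.
  by rewrite /pr -Quotient.idealrBE subr0.
split=> [zero x xA|sAB x].
  by have /eqP := zero (pr (Sub x xA)); rewrite pr0 SubK.
by rewrite -[x]reprK; apply/eqP; rewrite -/(pr _) pr0; apply/sAB/valP.
Qed.

End Coefficients.

(** * Reduction number zero as an equation between lengths *)

Section ReductionNumberZero.
Variables (R : comNzRingType) (m : ideal R).
Hypotheses (noethR : noetherian R) (locR : local_ring m).
Hypotheses (cmR : cohen_macaulay m) (dimR : krull_dim R 2).
Implicit Types (I J K L : ideal R) (a b : R).
Local Notation cofin := (cofin m).

Lemma m_primary_cofin K : m_primary m K -> cofin K.
Proof. by case=> _ radK; apply: (cofin_pow noethR) => x /radK. Qed.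

Lemma joint_reductionC I J a b : joint_reduction I J a b -> joint_reduction J I b a.
Proof.
move=> [aI bJ [r [s /ideal_ext eIJ]]]; split=> //; exists s, r => x.
by rewrite mulIC eIJ addIC (mulIC (I ^+ r)%I) (mulIC (I ^+ r.+1)%I).
Qed.

Lemma number0_joint_reduction I J a b : a \in I -> b \in J ->
  (I * J)%I = (a *: J + b *: I)%I -> joint_reduction I J a b.
Proof.
by move=> aI bJ eIJ; split=> //; exists 0%N, 0%N; rewrite !expI1 !expI0 mul1I mulI1 eIJ.
Qed.

(** As a is in I and b is in J, the colons I : a and J : b are the whole ring and the correction
    term of [lam_koszul] vanishes. *)
Lemma lam_koszul00 I J a b : cofin I -> cofin J -> a \in I -> b \in J ->
  cofin (pairI a b) ->
  lam (a *: J + b *: I)%I = (lam (pairI a b) + lam I + lam J)%N.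
Proof.
move=> cI cJ aI bJ cab.
have := lam_koszul noethR locR cmR dimR cab cJ cI.
rewrite (_ : capI _ _ = ideal1 R) ?(lam_ideal1 noethR locR); first lia.
by apply: ideal_eq => // x _; rewrite mem_capI !mem_colonI !ideal_memMr.
Qed.

Section FixedJointReduction.
Variables (I J : ideal R) (a b : R).
Hypotheses (cI : cofin I) (cJ : cofin J) (jr : joint_reduction I J a b).

(** The right-hand ideal lies in the left-hand one and its colength is known from [lam_koszul00], so
    equal lengths force equality. *)
Lemma number0_of_lam k :
  lam (I ^+ k * J ^+ k)%I = (k * k * lam (pairI a b) + lam (I ^+ k)%I + lam (J ^+ k)%I)%N ->
  (I ^+ k * J ^+ k = a ^+ k *: J ^+ k + b ^+ k *: I ^+ k)%I.
Proof.
move=> lamIJ; have cab := joint_reduction_cofin cI cJ jr; have [aI bJ _] := jr.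
have [aIk bJk] := (mem_expI k aI, mem_expI k bJ).
have cabk := cofin_pairX k k cab.
have lamab := lam_koszul00 (cofinX k cI) (cofinX k cJ) aIk bJk cabk.
apply/esym/(lam_eq noethR locR); last by rewrite lamab lamIJ (lam_pairX noethR locR).
- apply: cofinS (cofinM cabk (cofinM (cofinX k cI) (cofinX k cJ))) _.
  rewrite mulIDl /principal -!scaleIM !mul1I.
  by apply: addIS; apply: scaleIS; [apply: mulI_subr|apply: mulI_subl].
- apply: addI_sub => x; first exact: scaleI_mul.
  by move=> /(scaleI_mul bJk); rewrite mulIC.
Qed.

Variables (N : nat) (e20 e02 e10 e01 e00 : int).
Hypothesis HP : forall r s, (N <= r)%N -> (N <= s)%N ->
  (lam (I ^+ r * J ^+ s)%I)%:Z =
    e20 * 'C(r.+1, 2)%:Z + (lam (pairI a b))%:Z * r%:Z * s%:Z + e02 * 'C(s.+1, 2)%:Z -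
    e10 * r%:Z - e01 * s%:Z + e00.

(** Both sides compute the mixed difference of l(R/I^rJ^s) with step k in each direction: once from
    the joint reduction of the powers, once from the Hilbert polynomial. Hence the length does not
    depend on the chosen pair. *)
Lemma lam_joint_reduction_pow k a' b' : (0 < k)%N ->
  joint_reduction (I ^+ k)%I (J ^+ k)%I a' b' ->
  lam (pairI a' b') = (k * k * lam (pairI a b))%N.
Proof.
move=> k_gt0 /(joint_reduction_mixed noethR locR cmR dimR (cofinX k cI) (cofinX k cJ) (cofin1 m)).
move=> [r0 [s0 [N' [D mixed]]]].
have {}mixed p q : (N' <= p)%N -> (N' <= q)%N ->
    (lam (I ^+ (k * (r0 + p)) * J ^+ (k * (s0 + q)))%I + D =
     p * q * lam (pairI a' b') + lam (I ^+ (k * r0) * J ^+ (k * (s0 + q)))%I +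
     lam (I ^+ (k * (r0 + p)) * J ^+ (k * s0))%I)%N.
  by move=> le_p le_q; have := mixed p q le_p le_q; rewrite !mulI1 !expIM.
have lek r : (N <= k * (r + (N' + N)))%N by nia.
have M0 : (N' <= N' + N)%N by rewrite leq_addr.
have M1 : (N' <= (N' + N).+1)%N by apply: leqW.
have := mixed _ _ M0 M0; have := mixed _ _ M1 M0; have := mixed _ _ M0 M1; have := mixed _ _ M1 M1.
rewrite !addnS !mulnS.
have := lek r0; have := lek s0; move: (k * (r0 + _))%N (k * (s0 + _))%N => r s les ler.
have h00 := HP ler les; have h10 := HP (leq_trans ler (leq_addl k r)) les.
have h01 := HP ler (leq_trans les (leq_addl k s)).
have h11 := HP (leq_trans ler (leq_addl k r)) (leq_trans les (leq_addl k s)).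
move: h00 h10 h01 h11.
move: (lam (I ^+ r * J ^+ s)%I) (lam (I ^+ (k + r) * J ^+ s)%I) (lam (I ^+ r * J ^+ (k + s))%I).
move: (lam (I ^+ (k + r) * J ^+ (k + s))%I) (lam (I ^+ (k * r0) * J ^+ s)%I).
move: (lam (I ^+ (k * r0) * J ^+ (k + s))%I) (lam (I ^+ r * J ^+ (k * s0))%I).
move: (lam (I ^+ (k + r) * J ^+ (k * s0))%I) (lam (pairI a b)) (lam (pairI a' b')).
move: ('C(_, 2)) ('C(_, 2)) ('C(_, 2)) ('C(_, 2)) (N' + N)%N {lek M0 M1 mixed}.
rewrite !PoszD.
move=> c1 c2 c3 c4 p x2 e e' y2 x1 h11 y1 h00 h10 h01 H00 H10 H01 H11 m11 m01 m10 m00.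
have e'E : e'%:Z = h11%:Z - h10%:Z - h01%:Z + h00%:Z by lia.
lia.
Qed.

Lemma lam_of_number0 k : (0 < k)%N -> joint_reduction_number0 (I ^+ k)%I (J ^+ k)%I ->
  lam (I ^+ k * J ^+ k)%I = (k * k * lam (pairI a b) + lam (I ^+ k)%I + lam (J ^+ k)%I)%N.
Proof.
move=> k_gt0 [a' [b' [jr' /ideal_ext ->]]]; have [aI bJ _] := jr'.
rewrite -(lam_joint_reduction_pow k_gt0 jr').
apply: lam_koszul00 => //; try exact: cofinX.
by apply: joint_reduction_cofin jr'; apply: cofinX.
Qed.

End FixedJointReduction.

(* Multiplying I^NJ^N = a^NJ^N + b^NI^N by I^N makes M^1_(N,0)(a^N, b^N) vanish,
   and then the corresponding alternating sum of lengths is nonnegative. *)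
Lemma bigraded_coef_le I J a b N (e20 e02 e10 e01 e00 e1 e2 : int) :
  cofin I -> cofin J -> joint_reduction I J a b -> (0 < N)%N ->
  (forall r s, (N <= r)%N -> (N <= s)%N -> (lam (I ^+ r * J ^+ s)%I)%:Z =
    e20 * 'C(r.+1, 2)%:Z + (lam (pairI a b))%:Z * r%:Z * s%:Z + e02 * 'C(s.+1, 2)%:Z -
    e10 * r%:Z - e01 * s%:Z + e00) ->
  (forall n, (N <= n)%N -> (lam (I ^+ n)%I)%:Z = e20 * 'C(n.+1, 2)%:Z - e1 * n%:Z + e2) ->
  (I ^+ N * J ^+ N = a ^+ N *: J ^+ N + b ^+ N *: I ^+ N)%I ->
  (e10 <= e1)%R.
Proof.
move=> cI cJ jr N_gt0 HP IP eN; have cab := joint_reduction_cofin cI cJ jr.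
have [aI bJ _] := jr; have [aIN bJN] := (mem_expI N aI, mem_expI N bJ).
have eNN : (I ^+ (N + N) * J ^+ N = a ^+ N *: (I ^+ N * J ^+ N) + b ^+ N *: I ^+ (N + N))%I.
  by rewrite expID -mulIA {1}eN mulIDr -!scaleI_mull.
have cIJ := cofinM (cofinX N cI) (cofinX N cJ).
have := lam_koszul noethR locR cmR dimR (cofin_pairX N N cab) cIJ (cofinX (N + N) cI).
rewrite -eNN (lam_pairX noethR locR cmR dimR _ _ cab).
have : (lam (capI (colonI (I ^+ (N + N))%I (a ^+ N)) (colonI (I ^+ N * J ^+ N)%I (b ^+ N)))
        <= lam (I ^+ N)%I)%N.
  apply: (lam_le noethR locR); first exact: cofinX.
  move=> x xI; rewrite mem_capI !mem_colonI expID; apply/andP; split; first exact: mem_mulI.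
  by rewrite mulIC; apply: mem_mulI.
have := HP _ _ (leq_addr N N) (leqnn N); have := HP _ _ (leqnn N) (leqnn N).
have := IP _ (leq_addr N N); have := IP _ (leqnn N).
move: (lam _) (lam _) (lam _) (lam _) (lam _) (lam _) => l1 l2 l3 l4 l5 l6.
move: ('C(_, _)) ('C(_, _)) => c1 c2; rewrite PoszD.
move=> h1 h2 h3 h4 h5 h6.
(* The quadratic terms and N^2 l(R/(a, b)) cancel, leaving only the linear coefficients. *)
have : (0 <= (e1 - e10) * N%:Z)%R by lia.
by rewrite Num.Theory.pmulr_lge0 // Num.Theory.subr_ge0.
Qed.

End ReductionNumberZero.

Theorem theorem3p25 (R : comNzRingType) (m I J : ideal R) :
  noetherian R -> local_ring m -> cohen_macaulay m -> krull_dim R 2 ->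
  infinite_residue_field m -> m_primary m I -> m_primary m J ->
  [<-> (* (a) *)
       exists N, forall k, (N <= k)%N ->
         joint_reduction_number0 (I ^+ k)%I (J ^+ k)%I;
       (* (b) *)
       forall N, exists2 k, (N <= k)%N &
         joint_reduction_number0 (I ^+ k)%I (J ^+ k)%I;
       (* (c) *)
       [/\ bigraded_hilbert_coef I J 1 0 = hilbert_coef I 1,
           bigraded_hilbert_coef I J 0 1 = hilbert_coef J 1 &
           hilbert_coef (I * J)%I 2 = hilbert_coef I 2 + hilbert_coef J 2];
       (* (d) *)
       exists a b : R, joint_reduction I J a b /\
         exists N, forall k, (N <= k)%N -> zero_module (M1 I J k 0 0 a b)].
Proof.
move=> noethR locR cmR dimR infR primI primJ.
have cI := m_primary_cofin noethR primI; have cJ := m_primary_cofin noethR primJ.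
have [a [b jr]] := joint_reduction_exists noethR locR cmR dimR infR cI cJ.
have [e0I [e1I [e2I [e0J [e1J [e2J [e10 [e01 [e00 [N0 [PI0 PJ0 PH0]]]]]]]]]]] :=
  hilbert_polynomials noethR locR cmR dimR infR cI cJ jr.
(* A positive threshold, so that every k at least N satisfies 0 < k. *)
pose N := N0.+1.
have PI n (le_n : (N <= n)%N) := PI0 n (ltnW le_n).
have PJ n (le_n : (N <= n)%N) := PJ0 n (ltnW le_n).
have PH r s (le_r : (N <= r)%N) (le_s : (N <= s)%N) := PH0 r s (ltnW le_r) (ltnW le_s).
have hI : hilbert_coefs I (nth 0 [:: e0I; e1I; e2I]).
  exists N => n /PI <-; exists (lam (I ^+ n)%I) => //.
  exact/(module_length_lam noethR locR)/cofinX.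
have hJ : hilbert_coefs J (nth 0 [:: e0J; e1J; e2J]).
  exists N => n /PJ <-; exists (lam (J ^+ n)%I) => //.
  exact/(module_length_lam noethR locR)/cofinX.
pose e11 := (lam (pairI a b))%:Z.
(* The bigraded polynomial on the diagonal, rewritten with n^2 = 2 C(n+1, 2) - n; its constant term
   [e00] is thus e_2(IJ). *)
have hIJ : hilbert_coefs (I * J)%I (nth 0 [:: e0I + e0J + e11 + e11; e10 + e01 + e11; e00]).
  exists N => n le_n; exists (lam ((I * J) ^+ n)%I).
    exact/(module_length_lam noethR locR)/cofinX/cofinM.
  have bin2 : n%:Z * n%:Z = 'C(n.+1, 2)%:Z + 'C(n.+1, 2)%:Z - n%:Z.
    by elim: (n) => [|k IHk]; rewrite ?mulr0 // bin2S PoszS; lia.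
  rewrite expIMn (PH n n le_n le_n) /= -/e11 -mulrA bin2; ring.
pose eb i j := nth 0 (nth [::] [:: [:: e00; e01; e0J]; [:: e10; e11]; [:: e0I]] i) j.
have hb : bigraded_hilbert_coefs I J eb.
  exists N => r s le_r le_s; exists (lam (I ^+ r * J ^+ s)%I).
    by apply: (module_length_lam noethR locR); apply: cofinM; apply: cofinX.
  by rewrite bigraded_hilbert_sum (PH r s le_r le_s) /eb /= -/e11; ring.
rewrite (hilbert_coefE hI (i := 1)) // (hilbert_coefE hI (i := 2)) //.
rewrite (hilbert_coefE hJ (i := 1)) // (hilbert_coefE hJ (i := 2)) //.
rewrite (hilbert_coefE hIJ (i := 2)) //=; have [-> ->] := bigraded_hilbert_coefE hb.
rewrite /eb /=.
(* The binomial and k^2 terms cancel, which turns the length criterion into a linear equation in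
   k. *)
have lamE k : (N <= k)%N ->
    (lam (I ^+ k * J ^+ k)%I = k * k * lam (pairI a b) + lam (I ^+ k)%I + lam (J ^+ k)%I)%N
    <-> (e1I + e1J - e10 - e01) * k%:Z = e2I + e2J - e00.
  move=> le_k; have := PI k le_k; have := PJ k le_k; have := PH k k le_k le_k.
  by move: (lam _) (lam _) (lam _) (lam _) ('C(_, 2)) => *; split; lia.
have reduced : e1I + e1J - e10 - e01 = 0 -> e2I + e2J - e00 = 0 ->
    forall k, (N <= k)%N -> (I ^+ k * J ^+ k = a ^+ k *: J ^+ k + b ^+ k *: I ^+ k)%I.
  move=> al0 be0 k le_k; apply: (number0_of_lam noethR locR cmR dimR cI cJ jr).
  by apply/(lamE k le_k); rewrite al0 be0 mul0r.
split; [|split; [|split]].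
- by move=> [N1 aP] n; exists (maxn N1 n); [rewrite leq_maxr|apply/aP/leq_maxl].
- move=> bP; have [k1 le_k1 /(lam_of_number0 noethR locR cmR dimR cI cJ PH)] := bP N.
  move=> /(_ (leq_trans (ltn0Sn _) le_k1))/(lamE k1 le_k1) E1.
  (* A second exponent, strictly larger than the first, determines both the slope and the constant
     term. *)
  have [k2 lt_k2 /(lam_of_number0 noethR locR cmR dimR cI cJ PH)] := bP k1.+1.
  have le_k2 := leq_trans le_k1 (ltnW lt_k2).
  move=> /(_ (leq_trans (ltn0Sn _) le_k2))/(lamE k2 le_k2) E2.
  have al0 : e1I + e1J - e10 - e01 = 0.
    have /eqP : (e1I + e1J - e10 - e01) * (k2%:Z - k1%:Z) = 0 by rewrite mulrBr E1 E2 subrr.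
    rewrite mulf_eq0 => /orP[/eqP //|/eqP k12]; lia.
  have be0 : e2I + e2J - e00 = 0 by rewrite -E1 al0 mul0r.
  have eN := reduced al0 be0 N (leqnn N).
  (* The slope being zero, the inequalities [e10 <= e1I] and [e01 <= e1J] must both be
     equalities. *)
  have le10 := bigraded_coef_le noethR locR cmR dimR cI cJ jr (ltn0Sn _) PH PI eN.
  have PHC r s : (N <= r)%N -> (N <= s)%N -> (lam (J ^+ r * I ^+ s)%I)%:Z =
      e0J * 'C(r.+1, 2)%:Z + (lam (pairI b a))%:Z * r%:Z * s%:Z + e0I * 'C(s.+1, 2)%:Z -
      e01 * r%:Z - e10 * s%:Z + e00.
    by move=> le_r le_s; rewrite (pairIC b a) mulIC (PH s r le_s le_r) -/e11; ring.
  have le01 : e01 <= e1J := bigraded_coef_le noethR locR cmR dimR cJ cI (joint_reductionC jr)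
    (ltn0Sn N0) PHC PJ (etrans (mulIC _ _) (etrans eN (addIC _ _))).
  by split; lia.
(* The joint reduction fixed at the start works for every k at least N. *)
- move=> [E10 E01 E00]; exists a, b; split=> //; exists N => k le_k.
  apply/zero_subquotP; rewrite !add0n !expI0 mul1I mulI1.
  by rewrite (reduced _ _ k le_k) //; lia.
- move=> [a' [b' [[aI bJ _] [N1 dP]]]]; exists N1 => k /dP/zero_subquotP.
  rewrite !add0n !expI0 mul1I mulI1 => sub.
  have [aIk bJk] := (mem_expI k aI, mem_expI k bJ).
  have eIJ : (I ^+ k * J ^+ k = a' ^+ k *: J ^+ k + b' ^+ k *: I ^+ k)%I.
    apply: ideal_eq => //; apply: addI_sub => x; first exact: scaleI_mul.
    by move=> /(scaleI_mul bJk); rewrite mulIC.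
  exists (a' ^+ k), (b' ^+ k); split; last by rewrite eIJ.
  exact: number0_joint_reduction.
Qed.
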